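(* Consider problem (P1), over the transmit covariance matrix $\boldsymbol W\in\mathbb C^{N_t\times N_t}$ and assumed feasible, $$\min_{\boldsymbol W}\ \mathrm{PCRB}_\theta\quad\text{s.t.}\quad \log_2\left|\boldsymbol I_{N_u}+\frac{\boldsymbol H\boldsymbol W\boldsymbol H^H}{\sigma_c^2}\right|\ge\bar R,\quad \mathrm{tr}(\boldsymbol W)\le P,\quad \boldsymbol W\succeq\boldsymbol 0,$$ where $$\mathrm{PCRB}_\theta=\frac{1}{\sum_{k=1}^{K}\frac{p_k}{\sigma_k^2}-\rho+\frac{2|\alpha|^2L}{\sigma_s^2}\left(\mathrm{tr}((\boldsymbol{A}_1+\boldsymbol{A}_2)\boldsymbol{W})-\frac{|\mathrm{tr}(\boldsymbol{A}_3\boldsymbol{W})|^2}{\mathrm{tr}(\boldsymbol{A}_4\boldsymbol{W})}\right)} .$$ Writing $\boldsymbol W=\sum_{i=1}^{N_t}u_i\boldsymbol w_i\boldsymbol w_i^H$ with eigenvalues $u_i\ge0$ and eigenvectors $\boldsymbol w_i$, one has $\mathrm{tr}(\boldsymbol A_4\boldsymbol W)=N_r\int\sum_{i=1}^{N_t}u_i|\boldsymbol a^H(\theta)\boldsymbol w_i|^2p_\Theta(\theta)\,d\theta>0$, and (P1) is equivalent to problem (P3), over $\boldsymbol W$ and an auxiliary real variable $t$, $$\max_{\boldsymbol W,t}\ t\quad\text{s.t.}\quad \begin{bmatrix}\mathrm{tr}((\boldsymbol A_1+\boldsymbol A_2)\boldsymbol W)-t&\mathrm{tr}(\boldsymbol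 A_3\boldsymbol W)\\ \mathrm{tr}(\boldsymbol A_3^H\boldsymbol W)&\mathrm{tr}(\boldsymbol A_4\boldsymbol W)\end{bmatrix}\succeq\boldsymbol 0,\quad \log_2\left|\boldsymbol I_{N_u}+\frac{\boldsymbol H\boldsymbol W\boldsymbol H^H}{\sigma_c^2}\right|\ge\bar R,\quad \mathrm{tr}(\boldsymbol W)\le P,\quad \boldsymbol W\succeq\boldsymbol 0 .$$ Problem (P3) is a convex optimization problem, and the optimal solution of $\boldsymbol W$ to (P1) can be obtained as the optimal solution of $\boldsymbol W$ to (P3).
   Context: $N_t,N_r,N_u\ge1$ are the numbers of base-station transmit antennas, base-station receive antennas and user antennas; $L$ is the number of symbol intervals; $P$ is the transmit power budget; $\bar R$ is the communication rate threshold; $\sigma_c^2,\sigma_s^2$ are noise powers; $\alpha\in\mathbb C$ is the overall reflection coefficient of the target; $\boldsymbol H\in\mathbb C^{N_u\times N_t}$ is the channel matrix to the user. The superscript $H$ is conjugate transpose, $|\cdot|$ of a matrix is the determinant, and $\succeq\boldsymbol 0$ means positive semi-definite. The unknown random azimuth angle is $\theta\in[-\frac\pi2,\frac\pi2)$, and the steering vectors are $a_n(\theta)=e^{-j\pi d(N_t-2n+1)\cos\phi\sin\theta/\lambda}$ ($n=1,\dots,N_t$) and $b_m(\theta)=e^{-j\pi d(N_r-2m+1)\cos\phi\sin\theta/\lambda}$ ($m=1,\dots,N_r$), where $j$ is the imaginary unit, $d$ is the antenna spacing, $\lambda$ the wavelength, and $\cos\phi=\sqrt{r^2-h_B^2}/r$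 with $r$ the target distance and $h_B\ge0$ the antenna height; $\dot{\boldsymbol a}(\theta),\dot{\boldsymbol b}(\theta)$ are the derivatives with respect to $\theta$. The prior density of $\theta$ is the Gaussian mixture $p_\Theta(\theta)=\sum_{k=1}^K p_kf_k(\theta)$, $f_k(\theta)=\frac{1}{\sqrt{2\pi}\sigma_k}e^{-(\theta-\theta_k)^2/(2\sigma_k^2)}$, with $K\ge1$, $p_k\in[0,1]$, $\sum_kp_k=1$, $\theta_k\in[-\frac\pi2,\frac\pi2)$, and variances $\sigma_k^2$ sufficiently small that the probability for $\theta$ to exceed $[-\frac\pi2,\frac\pi2)$ is negligible. Integrals are over $\theta$. Define $$\rho=\int\frac{\sum_{k_1=1}^K\sum_{k_2=1}^K p_{k_1}p_{k_2}f_{k_1}(\theta)f_{k_2}(\theta)\left(\frac{\theta-\theta_{k_1}}{\sigma_{k_1}^2}-\frac{\theta-\theta_{k_2}}{\sigma_{k_2}^2}\right)^2}{2\sum_{k=1}^K p_kf_k(\theta)}\,d\theta ,$$ so that $\sum_k\frac{p_k}{\sigma_k^2}-\rho=\int\left(\frac{\partial\ln p_\Theta(\theta)}{\partial\theta}\right)^2p_\Theta(\theta)\,d\theta\ge0$, and $\boldsymbol A_1=\int\|\dot{\boldsymbol b}(\theta)\|^2\boldsymbol a(\theta)\boldsymbol a^H(\theta)p_\Theta(\theta)d\theta$, $\boldsymbol A_2=N_r\int\dot{\boldsymbol a}(\theta)\dot{\boldsymbol a}^H(\theta)p_\Theta(\theta)d\theta$, $\boldsymbol A_3=N_r\int\dot{\boldsymbol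 a}(\theta)\boldsymbol a^H(\theta)p_\Theta(\theta)d\theta$, $\boldsymbol A_4=N_r\int\boldsymbol a(\theta)\boldsymbol a^H(\theta)p_\Theta(\theta)d\theta$. $\mathrm{PCRB}_\theta$ is the posterior Cramér-Rao bound for estimating $\theta$.
   Formalization: Assumes R̄>0 (else W=0 may be feasible, with tr(A_4W)=0 and PCRB undefined), α≠0 and L≥1 (else PCRB is constant and the equivalence fails), r>h_B (else a(θ) is constant and tr(A_4W) may vanish), and d, λ, σ_c, σ_s, σ_k>0; integrals are over the real line. *)

(* Defs.v *)
From Stdlib Require List.
From mathcomp Require Import all_boot all_order all_algebra spectral.
From mathcomp Require Import all_classical all_reals all_analysis.
From mathcomp Require Export complex.
Set Implicit Arguments.
Unset Strict Implicit.
Unset Printing Implicit Defensive.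
Import Order.TTheory GRing.Theory Num.Theory.
Import numFieldNormedType.Exports.
Local Open Scope classical_set_scope.
Local Open Scope ring_scope.
Local Open Scope complex_scope.
Local Open Scope sesquilinear_scope.

Section ComplexMatrices.
Context {R : realType}.
Local Notation C := R[i].

(* In R[i], 0 <= z means that z is real and nonnegative. *)
Definition psd n (M : 'M[C]_n) : Prop :=
  M \is hermsymmx /\ forall x : 'cV[C]_n, 0 <= (x^t* *m M *m x) 0 0.

(* M = \sum_i u_i w_i w_i^H with eigenvalues u_i >= 0 and an orthonormal family
   of eigenvectors w_i. *)
Definition eigendecomposition n (M : 'M[C]_n) (u : 'I_n -> R)
    (w : 'I_n -> 'cV[C]_n) : Prop :=
  [/\ forall i, 0 <= u i,
      forall i, M *m w i = (u i)%:C *: w i,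
      forall i j, ((w i)^t* *m w j) 0 0 = (i == j)%:R
    & M = \sum_i (u i)%:C *: (w i *m (w i)^t*)].

(* Integrals and derivatives in a real variable of complex matrix-valued
   functions are taken entrywise, on real and imaginary parts. *)
Definition cintegral (f : R -> C) : C :=
  (\int[lebesgue_measure]_x complex.Re (f x)) +i*
  (\int[lebesgue_measure]_x complex.Im (f x)).

Definition mxintegral m n (f : R -> 'M[C]_(m, n)) : 'M[C]_(m, n) :=
  \matrix_(i, j) cintegral (fun x => f x i j).

Definition mxderive m n (f : R -> 'M[C]_(m, n)) (x : R) : 'M[C]_(m, n) :=
  \matrix_(i, j) (derive1 (fun y => complex.Re (f y i j)) x +i*
                  derive1 (fun y => complex.Im (f y i j)) x).

Definition log2 (x : R) : R := ln x / ln 2.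

End ComplexMatrices.

Section Optimization.
Context {R : realType}.
Local Notation C := R[i].

Definition minimizer T (F : set T) (f : T -> R) (x : T) : Prop :=
  F x /\ forall y, F y -> f x <= f y.

Definition maximizer T (F : set T) (f : T -> R) (x : T) : Prop :=
  F x /\ forall y, F y -> f y <= f x.

(* The decision variable is a complex n x n matrix together with a real number,
   seen as a real vector space. *)
Definition cvxcomb n (s : R) (x y : 'M[C]_n * R) : 'M[C]_n * R :=
  (s%:C *: x.1 + (1 - s)%:C *: y.1, s * x.2 + (1 - s) * y.2).

Definition convex_dom n (D : set ('M[C]_n * R)) : Prop :=
  forall s x y, 0 <= s <= 1 -> D x -> D y -> D (cvxcomb s x y).

Definition concave_on n (D : set ('M[C]_n * R)) (f : 'M[C]_n * R -> R) : Prop :=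
  forall s x y, 0 <= s <= 1 -> D x -> D y ->
    s * f x + (1 - s) * f y <= f (cvxcomb s x y).

(* Concavity with respect to the Loewner order. *)
Definition mxconcave_on n (D : set ('M[C]_n * R)) m
    (G : 'M[C]_n * R -> 'M[C]_m) : Prop :=
  forall s x y, 0 <= s <= 1 -> D x -> D y ->
    psd (G (cvxcomb s x y) - (s%:C *: G x + (1 - s)%:C *: G y)).

(* Maximize [objective x] over x in [domain] subject to 0 <= g x for every g in
   [inequalities], and to [lmi x] positive semidefinite. *)
Record program n := Program {
  domain : set ('M[C]_n * R);
  objective : 'M[C]_n * R -> R;
  inequalities : seq ('M[C]_n * R -> R);
  lmi_size : nat;
  lmi : 'M[C]_n * R -> 'M[C]_lmi_size }.

Definition feasible n (p : program n) : set ('M[C]_n * R) :=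
  [set x | [/\ domain p x, forall g, List.In g (inequalities p) -> 0 <= g x
             & psd (lmi p x)]].

Definition optimal n (p : program n) : 'M[C]_n * R -> Prop :=
  maximizer (feasible p) (objective p).

Definition convex_program n (p : program n) : Prop :=
  [/\ convex_dom (domain p), concave_on (domain p) (objective p),
      forall g, List.In g (inequalities p) -> concave_on (domain p) g
    & mxconcave_on (domain p) (lmi p)].

End Optimization.

Record system (R : realType) := System {
  Nt : nat;                        (* base-station transmit antennas *)
  Nr : nat;                        (* base-station receive antennas *)
  Nu : nat;                        (* user antennas *)
  L : nat;                         (* symbol intervals *)
  power : R;                       (* P *)
  rate_threshold : R;              (* \bar R *)
  sigma_c : R;                     (* square root of the noise power at the user *)
  sigma_s : R;                     (* square root of the sensing noise power *)
  alpha : R[i];                    (* overall reflection coefficient *)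
  channel : 'M[R[i]]_(Nu, Nt);     (* H *)
  spacing : R;                     (* d *)
  wavelength : R;                  (* lambda *)
  distance : R;                    (* r *)
  height : R;                      (* h_B *)
  K : nat;
  weight : 'I_K -> R;              (* p_k *)
  mean : 'I_K -> R;                (* theta_k *)
  stdev : 'I_K -> R }.             (* sigma_k *)

Section Model.
Context {R : realType} (S : system R).
Local Notation C := R[i].
Local Notation W_t := ('M[C]_(Nt S)).

Definition cos_phi : R :=
  Num.sqrt (distance S ^+ 2 - height S ^+ 2) / distance S.

(* Entries exp(- j x) = cos x - j sin x; indices are 0-based, hence n = k.+1. *)
Definition steering N (theta : R) : 'cV[C]_N :=
  \col_(k < N)
    let x := pi * spacing S * (N%:R - 2 * k.+1%:R + 1) * cos_phi * sin theta
             / wavelength S in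
    cos x -i* sin x.

Definition a : R -> 'cV[C]_(Nt S) := steering (Nt S).
Definition b : R -> 'cV[C]_(Nr S) := steering (Nr S).
Definition a' : R -> 'cV[C]_(Nt S) := mxderive a.
Definition b' : R -> 'cV[C]_(Nr S) := mxderive b.

Definition f (k : 'I_(K S)) (theta : R) : R :=
  normal_pdf (mean k) (stdev k) theta.

Definition prior (theta : R) : R := \sum_(k < K S) weight k * f k theta.

Definition rho : R :=
  \int[lebesgue_measure]_theta
    ((\sum_(k1 < K S) \sum_(k2 < K S) weight k1 * weight k2 * f k1 theta * f k2 theta *
        ((theta - mean k1) / stdev k1 ^+ 2
         - (theta - mean k2) / stdev k2 ^+ 2) ^+ 2)
     / (2 * \sum_(k < K S) weight k * f k theta)).

Definition A1 : W_t :=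
  mxintegral (fun theta => (\sum_m `|b' theta m 0| ^+ 2) *:
    ((prior theta)%:C *: (a theta *m (a theta)^t*))).

Definition A2 : W_t :=
  (Nr S)%:R *:
  mxintegral (fun theta => (prior theta)%:C *: (a' theta *m (a' theta)^t*)).

Definition A3 : W_t :=
  (Nr S)%:R *:
  mxintegral (fun theta => (prior theta)%:C *: (a' theta *m (a theta)^t*)).

Definition A4 : W_t :=
  (Nr S)%:R *:
  mxintegral (fun theta => (prior theta)%:C *: (a theta *m (a theta)^t*)).

Definition prior_information : R :=
  \sum_(k < K S) weight k / stdev k ^+ 2 - rho.

Definition snr_factor : R :=
  2 * complex.Re `|alpha S| ^+ 2 * (L S)%:R / sigma_s S ^+ 2.

(* [Re] below only moves to R quantities that are real when W is Hermitian.
   1 / 0 = 0 here; the denominators are nonzero at every W with tr (A4 W) > 0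
   and W positive semidefinite. *)
Definition PCRB (W : W_t) : R :=
  1 / (prior_information + snr_factor *
    (complex.Re (\tr ((A1 + A2) *m W))
     - complex.Re `|\tr (A3 *m W)| ^+ 2 / complex.Re (\tr (A4 *m W)))).

Definition rate (W : W_t) : R :=
  log2 (complex.Re (\det (1%:M +
    ((sigma_c S ^+ 2)^-1)%:C *: (channel S *m W *m (channel S)^t*)))).

Definition P1_feasible : set W_t :=
  [set W | [/\ rate_threshold S <= rate W, complex.Re (\tr W) <= power S & psd W]].

Definition P1_optimal : W_t -> Prop := minimizer P1_feasible PCRB.

Definition schur_block (W : W_t) (t : R) : 'M[C]_(1 + 1) :=
  block_mx (\tr ((A1 + A2) *m W) - t%:C)%:M (\tr (A3 *m W))%:M
           (\tr (A3^t* *m W))%:M            (\tr (A4 *m W))%:M.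

Definition P3 : program (R := R) (Nt S) := {|
  domain := [set x | psd x.1];
  objective := fun x => x.2;
  inequalities := [:: (fun x => rate x.1 - rate_threshold S);
                      (fun x => power S - complex.Re (\tr x.1))];
  lmi := fun x => schur_block x.1 x.2 |}.

End Model.

Arguments PCRB {R} S W.
Arguments rate {R} S W.
Arguments P1_feasible {R} S _.
Arguments P1_optimal {R} S W.
Arguments schur_block {R} S W t.

(* Main.v *)
(** For W positive semidefinite, tr (A4 W) integrates the trigonometric polynomial
    a^H W a >= 0 against the positive prior; a nonzero W cannot annihilate the whole array
    manifold, because a polynomial has finitely many roots on the unit circle.  Hence
    tr (A4 W) > 0 on the feasible set (where W != 0 since the rate is positive), and by the
    Schur complement (W, t) is feasible for (P3) iff W is feasible for (P1) and t <= F W, where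
    F W is the bracket in PCRB = 1 / (I + s F W).  Here s > 0, F >= 0 by Cauchy-Schwarz for the
    form W, and the prior information I is positive, being at least the integral of
    (p')^2 / p.  So PCRB is a decreasing function of F and both problems maximize F.  Convexity
    of (P3) reduces to concavity of log det, which follows by simultaneous diagonalization from
    that of ln. *)

Require Import Defs.
From mathcomp Require Import all_boot all_order all_algebra spectral.
From mathcomp Require Import all_classical all_reals all_analysis.
From mathcomp Require Import measurable_realfun ring lra.
Import Order.TTheory GRing.Theory Num.Theory.
Import numFieldNormedType.Exports.
Local Open Scope classical_set_scope.
Local Open Scope ring_scope.
Local Open Scope complex_scope.
Local Open Scope sesquilinear_scope.

(** * Positive semidefinite Hermitian matrices: spectral form, pencils, 2 x 2 Schur complements *)

Section HermitianMatrices.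
Set Implicit Arguments.
Unset Strict Implicit.
Context {C : numClosedFieldType}.

(** Same body as [psd], over an abstract closed field; at [R[i]] the two are convertible. *)
Definition hermpsd n (M : 'M[C]_n) : Prop :=
  M \is hermsymmx /\ forall x : 'cV[C]_n, 0 <= (x^t* *m M *m x) 0 0.

Lemma adjmxM m n p (A : 'M[C]_(m, n)) (B : 'M[C]_(n, p)) :
  (A *m B)^t* = B^t* *m A^t*.
Proof. by rewrite trmx_mul map_mxM. Qed.

Lemma adjmxD m n (A B : 'M[C]_(m, n)) : (A + B)^t* = A^t* + B^t*.
Proof. by rewrite linearD/= map_mxD. Qed.

Lemma adjmxZ m n (c : C) (A : 'M[C]_(m, n)) : (c *: A)^t* = Num.conj c *: A^t*.
Proof. by rewrite linearZ/= map_mxZ. Qed.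

Lemma hermsymmxP n (M : 'M[C]_n) : M \is hermsymmx <-> M = M^t*.
Proof.
by split=> [/is_hermitianmxP|h]; last apply/is_hermitianmxP; rewrite expr0 scale1r.
Qed.

Lemma conj_ge0_id (z : C) : 0 <= z -> Num.conj z = z.
Proof. by move=> /ger0_real/CrealP. Qed.

Lemma mxtrace_rank1 n (v : 'cV[C]_n) (w : 'cV[C]_n) (W : 'M[C]_n) :
  \tr (v *m w^t* *m W) = (w^t* *m W *m v) 0 0.
Proof. by rewrite -mulmxA mxtrace_mulC /mxtrace big_ord1. Qed.

Lemma adjmx_mul_ge0 n (v : 'cV[C]_n) : 0 <= (v^t* *m v) 0 0.
Proof.
rewrite mxE; apply: sumr_ge0 => i _.
by rewrite !mxE mulrC mul_conjC_ge0.
Qed.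

Lemma hermpsdD n (A B : 'M[C]_n) : hermpsd A -> hermpsd B -> hermpsd (A + B).
Proof.
move=> [/hermsymmxP hA pA] [/hermsymmxP hB pB]; split.
  by apply/hermsymmxP; rewrite adjmxD -hA -hB.
by move=> x; rewrite mulmxDr mulmxDl mxE addr_ge0.
Qed.

Lemma hermpsdZ n (c : C) (A : 'M[C]_n) : 0 <= c -> hermpsd A -> hermpsd (c *: A).
Proof.
move=> c0 [/hermsymmxP hA pA]; split.
  by apply/hermsymmxP; rewrite adjmxZ -hA conj_ge0_id.
by move=> x; rewrite -scalemxAr -scalemxAl mxE mulr_ge0.
Qed.

Lemma hermpsd1 n : hermpsd (1%:M : 'M[C]_n).
Proof.
split; first by apply/hermsymmxP; rewrite trmx1 map_mx1.
by move=> x; rewrite mulmx1 adjmx_mul_ge0.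
Qed.

Lemma hermpsd0 n : hermpsd (0 : 'M[C]_n).
Proof.
split; first by apply/hermsymmxP; rewrite trmx0 map_mx0.
by move=> x; rewrite mulmx0 mul0mx mxE.
Qed.

Lemma hermpsd_congr m n (B : 'M[C]_(m, n)) (A : 'M[C]_n) :
  hermpsd A -> hermpsd (B *m A *m B^t*).
Proof.
move=> [/hermsymmxP hA pA]; split.
  by apply/hermsymmxP; rewrite !adjmxM trmxCK -hA mulmxA.
move=> x; have := pA (B^t* *m x).
by rewrite adjmxM trmxCK !mulmxA.
Qed.

Lemma hermpsd_spectral n (M : 'M[C]_n) : hermpsd M ->
  exists (P : 'M[C]_n) (u : 'I_n -> C),
    [/\ P \is unitarymx, forall i, 0 <= u i
      & M = P^t* *m diag_mx (\row_i u i) *m P].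
Proof.
move=> [hM pM]; set P := spectralmx M.
have uP : P \is unitarymx by exact: spectral_unitarymx.
have /(orthomx_spectralP) eM := hermitian_normalmx hM.
have PP : P *m P^t* = 1%:M by exact/unitarymxP.
have {}eM : M = P^t* *m diag_mx (spectral_diag M) *m P.
  by rewrite -invmx_unitary.
exists P, (fun i => spectral_diag M 0 i); split; first by [].
  (* The form at the i-th column of P^H is exactly the i-th spectral value. *)
  move=> i; have := pM (P^t* *m (delta_mx i 0)).
  rewrite adjmxM trmxCK eM !mulmxA -(mulmxA _ P) PP mulmx1 -(mulmxA _ P) PP mulmx1.
  rewrite trmx_delta map_delta_mx -rowE -colE !mxE eqxx mulr1n.
  by rewrite -eM.
by have -> : \row_i (spectral_diag M 0 i) = spectral_diag M by apply/rowP => i; rewrite mxE.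
Qed.

Lemma hermpsd_eigen n (M : 'M[C]_n) : hermpsd M ->
  exists (u : 'I_n -> C) (w : 'I_n -> 'cV[C]_n),
  [/\ forall i, 0 <= u i,
      forall i, M *m w i = u i *: w i,
      forall i j, ((w i)^t* *m w j) 0 0 = (i == j)%:R
    & M = \sum_i u i *: (w i *m (w i)^t*)].
Proof.
move=> /hermpsd_spectral[P [u [uP u0 eM]]].
have PP : P *m P^t* = 1%:M by exact/unitarymxP.
pose w i : 'cV[C]_n := P^t* *m delta_mx i 0.
exists u, w; split => //.
- move=> i; rewrite eM /w mulmxA -(mulmxA _ P) PP mulmx1 -mulmxA.
  rewrite -[diag_mx _ *m _]colE scalemxAr; congr (_ *m _).
  apply/colP => j; rewrite !mxE eqxx andbT; case: eqVneq => [->|]; rewrite ?mulr1//.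
  by rewrite mulr0.
- move=> i j; rewrite /w adjmxM trmxCK mulmxA -(mulmxA _ P) PP mulmx1.
  by rewrite trmx_delta map_delta_mx -rowE !mxE eqxx andbT.
- rewrite {1}eM; apply/matrixP => k l; rewrite mul_mx_diag mxE summxE.
  apply: eq_bigr => i _; rewrite /w adjmxM trmxCK trmx_delta map_delta_mx -rowE.
  by rewrite -colE !mxE big_ord1 !mxE mulrAC mulrC mulrA.
Qed.

(** B = P^H D^(1/2), with D the nonnegative diagonal of the spectral form. *)
Lemma hermpsd_factor n (M : 'M[C]_n) : hermpsd M ->
  exists B : 'M[C]_n, M = B *m B^t*.
Proof.
move=> /hermpsd_spectral[P [u [_ u0 ->]]].
pose D : 'M[C]_n := diag_mx (\row_i sqrtC (u i)).
exists (P^t* *m D); rewrite adjmxM trmxCK /D tr_diag_mx map_diag_mx !mulmxA.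
congr (_ *m _); rewrite -mulmxA mulmx_diag; congr (_ *m diag_mx _).
apply/rowP => i; rewrite !mxE [X in _ * X]conj_ge0_id ?sqrtC_ge0//.
by rewrite -expr2 sqrtCK.
Qed.

(** Unitary conjugation makes the pencil diagonal. One family [u] serves all s and t, so
    determinants at different points of a segment can be compared. *)
Lemma hermpsd_det n (M : 'M[C]_n) : hermpsd M ->
  exists2 u : 'I_n -> C, forall i, 0 <= u i &
    forall s t : C, \det (s *: 1%:M + t *: M) = \prod_i (s + t * u i).
Proof.
move=> /hermpsd_spectral[P [u [uP u0 ->]]]; exists u => // s t.
have PP : P *m P^t* = 1%:M by exact/unitarymxP.
have PP' : P^t* *m P = 1%:M by rewrite -invmx_unitary// mulVmx// unitarymx_unit.
pose D := diag_mx (\row_i (s + t * u i)).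
have -> : s *: 1%:M + t *: (P^t* *m diag_mx (\row_i u i) *m P) = P^t* *m D *m P.
  have -> : D = s *: 1%:M + t *: diag_mx (\row_i u i).
    apply/matrixP => i j; rewrite !mxE; case: (i == j); rewrite ?mulr0n ?mulr1n.
      by rewrite mulr1.
    by rewrite !mulr0 addr0.
  by rewrite mulmxDr mulmxDl -!scalemxAr -!scalemxAl mulmx1 PP'.
rewrite !det_mulmx mulrC mulrA -det_mulmx PP det1 mul1r det_diag.
by apply: eq_bigr => i _; rewrite mxE.
Qed.

(* Writing X = B B^H, the congruence by B^-1 reduces the pencil to the identity and a single
   positive semidefinite matrix. *)
Lemma hermpsd_pencil_det n (X Y : 'M[C]_n) :
  hermpsd X -> hermpsd Y -> \det X != 0 ->
  exists2 u : 'I_n -> C, forall i, 0 <= u i &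
    forall s t : C, \det (s *: X + t *: Y) = \det X * \prod_i (s + t * u i).
Proof.
move=> pX pY dX.
have [B eX] := hermpsd_factor pX.
have uB : B \in unitmx.
  rewrite unitmxE unitfE; apply: contraNneq dX => B0.
  by rewrite eX det_mulmx B0 mul0r.
pose M := invmx B *m Y *m (invmx B)^t*.
have eY : Y = B *m M *m B^t*.
  rewrite /M !mulmxA mulmxV// mul1mx -mulmxA -adjmxM mulmxV//.
  by rewrite trmx1 map_mx1 mulmx1.
have [u u0 dM] := hermpsd_det (hermpsd_congr (invmx B) pY : hermpsd M).
exists u => // s t; rewrite -dM eX eY.
have -> : s *: (B *m B^t*) + t *: (B *m M *m B^t*) =
    B *m (s *: 1%:M + t *: M) *m B^t*.
  by rewrite mulmxDr mulmxDl -!scalemxAr -!scalemxAl mulmx1.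
by rewrite !det_mulmx mulrAC.
Qed.

(** Entries of unit eigenvectors have modulus at most 1, so the spectral sum bounds each entry by
    the sum of the eigenvalues, which is the trace. *)
Lemma hermpsd_entry_le n (W : 'M[C]_n) i j : hermpsd W -> `|W i j| <= \tr W.
Proof.
move=> pW; have [u [w [u0 _ on eW]]] := hermpsd_eigen pW.
have n1 k : \sum_l `|w k l 0| ^+ 2 = 1.
  have := on k k; rewrite eqxx mulr1n mxE => <-.
  by apply: eq_bigr => l _; rewrite !mxE normCK mulrC.
have w1 k l : `|w k l 0| <= 1.
  rewrite -(@ler_pXn2r _ 2)// ?nnegrE// expr1n -(n1 k) (bigD1 l)//= lerDl.
  by apply: sumr_ge0 => m _; rewrite exprn_ge0.
have -> : \tr W = \sum_k u k.
  rewrite eW raddf_sum/=; apply: eq_bigr => k _.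
  by rewrite mxtraceZ mxtrace_mulC /mxtrace big_ord1 on eqxx mulr1.
rewrite {1}eW summxE; apply: le_trans (ler_norm_sum _ _ _) _.
apply: ler_sum => k _; rewrite !mxE big_ord1 !mxE !normrM norm_conjC.
rewrite ger0_norm// ler_piMr//.
by rewrite mulr_ile1.
Qed.

Lemma mxtrace_mul_bounded n (A : 'M[C]_n) (W : 'M[C]_n) : hermpsd W ->
  `|\tr (A *m W)| <= (\sum_i \sum_j `|A i j|) * \tr W.
Proof.
move=> pW; apply: le_trans (ler_norm_sum _ _ _) _.
rewrite mulr_suml; apply: ler_sum => i _; rewrite mxE.
apply: le_trans (ler_norm_sum _ _ _) _.
rewrite mulr_suml; apply: ler_sum => j _.
by rewrite normrM ler_wpM2l// hermpsd_entry_le.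
Qed.

Lemma mxtrace_adjmx n (A W : 'M[C]_n) : W = W^t* ->
  \tr (A^t* *m W) = Num.conj (\tr (A *m W)).
Proof.
by move=> hW; rewrite {1}hW -adjmxM mxtrace_mulC trace_map_mx mxtrace_tr.
Qed.

(** Schur complement with respect to the positive lower right entry. *)
Lemma hermpsd_2x2 (x y d : C) : x \is Num.real -> 0 < d ->
  hermpsd (block_mx x%:M y%:M (Num.conj y)%:M d%:M : 'M[C]_(1 + 1)) <->
  `|y| ^+ 2 / d <= x.
Proof.
move=> xr d0; rewrite ler_pdivrMr//.
have xc : Num.conj x = x by apply/CrealP.
have dc : Num.conj d = d by apply: conj_ge0_id; exact: ltW.
have qE (p q : 'cV[C]_1) : ((col_mx p q)^t* *m
    block_mx x%:M y%:M (Num.conj y)%:M d%:M *m col_mx p q) 0 0 =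
  Num.conj (p 0 0) * x * p 0 0 + Num.conj (q 0 0) * Num.conj y * p 0 0 +
  (Num.conj (p 0 0) * y * q 0 0 + Num.conj (q 0 0) * d * q 0 0).
  rewrite tr_col_mx map_row_mx mul_row_block mul_row_col !mul_mx_scalar.
  by rewrite mxE !mulmxDl -!scalemxAl !mxE !big_ord1 !mxE; ring.
split=> [[_ /(_ (col_mx d%:M (- Num.conj y)%:M))]|le].
  rewrite qE !mxE eqxx !mulr1n dc rmorphN/= conjCK.
  set e := (X in 0 <= X -> _); have -> : e = d * (x * d - `|y| ^+ 2).
    by rewrite /e normCK; ring.
  by rewrite pmulr_rge0// subr_ge0.
split=> [|v].
  apply/hermsymmxP; rewrite tr_block_mx map_block_mx !tr_scalar_mx !map_scalar_mx/=.
  by rewrite conjCK xc dc.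
rewrite -(vsubmxK v) qE; set p := _ 0 0; set q := _ 0 0.
(* Multiplying by d > 0 lets the square be completed without division. *)
set e := (X in 0 <= X); rewrite -(@pmulr_rge0 _ d)//.
have -> : d * e = `|d * q + Num.conj y * p| ^+ 2 + (x * d - `|y| ^+ 2) * `|p| ^+ 2.
  by rewrite /e !normCK !(rmorphM, rmorphD)/= conjCK dc; ring.
by rewrite addr_ge0// ?mulr_ge0 ?exprn_ge0// subr_ge0.
Qed.

Lemma hermsymm_form_conj n (W : 'M[C]_n) (v w : 'cV[C]_n) : W = W^t* ->
  Num.conj ((v^t* *m W *m w) 0 0) = (w^t* *m W *m v) 0 0.
Proof.
move=> hW; have -> : w^t* *m W *m v = (v^t* *m W *m w)^t*.
  by rewrite !adjmxM trmxCK -hW mulmxA.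
by rewrite !mxE.
Qed.

(** This is p times the form of W at v - z w. The sum is nested to the right, in the shape that
    [schur_min] and [cintegral_schur] expect. *)
Lemma hermpsd_form_expand n (W : 'M[C]_n) (v w : 'cV[C]_n) (p z : C) :
  hermpsd W -> 0 <= p ->
  let c := p * (w^t* *m W *m v) 0 0 in
  0 <= p * (v^t* *m W *m v) 0 0 + (- Num.conj z * c + (- z * Num.conj c +
       z * Num.conj z * (p * (w^t* *m W *m w) 0 0))).
Proof.
move=> [/hermsymmxP hW qW] p0 /=.
have := mulr_ge0 p0 (qW (v + (- z) *: w)).
rewrite rmorphM/= [Num.conj p]conj_ge0_id// hermsymm_form_conj//.
rewrite adjmxD adjmxZ !mulmxDl !mulmxDr -!scalemxAl -!scalemxAr.
set m22 := _ *m W *m v; set m23 := v^t* *m W *m w.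
set m32 := w^t* *m W *m v; set m33 := _ *m W *m w.
move: m22 m23 m32 m33 => m22 m23 m32 m33.
rewrite !mxE rmorphN/= => h; apply: le_trans h _.
by rewrite le_eqVlt; apply/orP; left; apply/eqP; ring.
Qed.

Lemma eigen_form n m (c : 'I_m -> C) (w : 'I_m -> 'cV[C]_n) (v : 'cV[C]_n) :
  (v^t* *m (\sum_i c i *: (w i *m (w i)^t*)) *m v) 0 0 =
  \sum_i c i * `|(v^t* *m w i) 0 0| ^+ 2.
Proof.
rewrite mulmx_sumr mulmx_suml summxE; apply: eq_bigr => i _.
rewrite -scalemxAr -scalemxAl [LHS]mxE; congr (_ * _).
have -> : v^t* *m (w i *m (w i)^t*) *m v = (v^t* *m w i) *m ((w i)^t* *m v).
  by rewrite !mulmxA.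
rewrite normCK [LHS]mxE big_ord1; congr (_ * _).
have -> : (w i)^t* *m v = (v^t* *m w i)^t* by rewrite adjmxM trmxCK.
by rewrite !mxE.
Qed.

Lemma congr_affine m n (c s t : C) (B : 'M[C]_(m, n)) (X Y : 'M[C]_n) : s + t = 1 ->
  1%:M + c *: (B *m (s *: X + t *: Y) *m B^t*) =
  s *: (1%:M + c *: (B *m X *m B^t*)) + t *: (1%:M + c *: (B *m Y *m B^t*)).
Proof.
move=> st; rewrite mulmxDr mulmxDl -!scalemxAr -!scalemxAl !scalerDr addrACA.
rewrite -scalerDl st scale1r; congr (_ + (_ + _)); rewrite !scalerA; congr (_ *: _).
  exact: mulrC.
exact: mulrC.
Qed.

Lemma hermpsd_diag_ge0 n (W : 'M[C]_n) i : hermpsd W -> 0 <= W i i.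
Proof.
move=> [_ /(_ (delta_mx i 0))].
by rewrite trmx_delta map_delta_mx -rowE -colE !mxE.
Qed.

(** The quadratic in z attains its minimum c2 - |c3|^2 / c4 at z = c3 / c4; evaluate there and scale
    by N. *)
Lemma schur_min (N c2 c3 c4 : C) : 0 < N -> 0 < c4 ->
  (forall z, 0 <= c2 + (- Num.conj z * c3 + (- z * Num.conj c3 + z * Num.conj z * c4))) ->
  `|N * c3| ^+ 2 / (N * c4) <= N * c2.
Proof.
move=> N0 c40 h.
have cc4 : Num.conj c4 = c4 by apply: conj_ge0_id; exact: ltW.
have c4n := lt0r_neq0 c40; have Nn := lt0r_neq0 N0.
rewrite normrM exprMn normCK normCK (conj_ge0_id (ltW N0)) -subr_ge0.
have := mulr_ge0 (ltW N0) (h (c3 / c4)).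
rewrite fmorph_div/= cc4; set k := Num.conj c3 => h'; apply: le_trans h' _.
by rewrite le_eqVlt; apply/orP; left; apply/eqP; field; rewrite Nn c4n.
Qed.
Lemma mxtrace_affine n (A X Y : 'M[C]_n) (s t : C) :
  \tr (A *m (s *: X + t *: Y)) = s * \tr (A *m X) + t * \tr (A *m Y).
Proof. by rewrite mulmxDr -!scalemxAr mxtraceD !mxtraceZ. Qed.

Lemma block_scalar_affine (s t p q b c d b' c' d' x y : C) :
  s *: (block_mx (p - x)%:M b%:M c%:M d%:M : 'M[C]_(1 + 1)) +
  t *: block_mx (q - y)%:M b'%:M c'%:M d'%:M =
  block_mx (s * p + t * q - (s * x + t * y))%:M (s * b + t * b')%:M
    (s * c + t * c')%:M (s * d + t * d')%:M.
Proof.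
rewrite !scale_block_mx add_block_mx !scale_scalar_mx -!raddfD/=.
by congr (block_mx _%:M _ _ _); ring.
Qed.

Lemma block_mxtrace_affine n (A B B' D X Y : 'M[C]_n) (s t x y z : C) :
  z = s * x + t * y ->
  block_mx (\tr (A *m (s *: X + t *: Y)) - z)%:M
    (\tr (B *m (s *: X + t *: Y)))%:M (\tr (B' *m (s *: X + t *: Y)))%:M
    (\tr (D *m (s *: X + t *: Y)))%:M =
  s *: (block_mx (\tr (A *m X) - x)%:M (\tr (B *m X))%:M
         (\tr (B' *m X))%:M (\tr (D *m X))%:M : 'M[C]_(1 + 1)) +
  t *: block_mx (\tr (A *m Y) - y)%:M (\tr (B *m Y))%:M
         (\tr (B' *m Y))%:M (\tr (D *m Y))%:M.
Proof. by move=> ->; rewrite !mxtrace_affine block_scalar_affine. Qed.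

Lemma hermpsd_block_mxtrace n (A B D W : 'M[C]_n) (t : C) : W = W^t* ->
  \tr (A *m W) - t \is Num.real -> 0 < \tr (D *m W) ->
  hermpsd (block_mx (\tr (A *m W) - t)%:M (\tr (B *m W))%:M
            (\tr (B^t* *m W))%:M (\tr (D *m W))%:M : 'M[C]_(1 + 1)) <->
  `|\tr (B *m W)| ^+ 2 / \tr (D *m W) <= \tr (A *m W) - t.
Proof. by move=> hW xr d0; rewrite mxtrace_adjmx//; exact: hermpsd_2x2. Qed.
End HermitianMatrices.

(** * Eigendecompositions over [R[i]] and concavity of log det *)

Section ComplexMatrixTheory.
Set Implicit Arguments.
Unset Strict Implicit.
Context {R : realType}.
Local Notation C := R[i].

Lemma psdE n (M : 'M[C]_n) : psd M <-> hermpsd M.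
Proof. by []. Qed.

Lemma Re_ge0 (z : C) : 0 <= z -> 0 <= complex.Re z.
Proof. by rewrite lecE => /andP[]. Qed.

Lemma Re_gt0 (z : C) : 0 < z -> 0 < complex.Re z.
Proof. by rewrite ltcE => /andP[]. Qed.

Lemma ge0_ReK (z : C) : 0 <= z -> (complex.Re z)%:C = z.
Proof. by move=> /ger0_real/RRe_real. Qed.

Lemma psd_eigendecomposition n (M : 'M[C]_n) : psd M ->
  exists u w, eigendecomposition M u w.
Proof.
move=> /psdE/hermpsd_eigen[u [w [u0 e1 e2 e3]]].
exists (fun i => complex.Re (u i)), w; split.
- by move=> i; exact: Re_ge0.
- by move=> i; rewrite ge0_ReK.
- exact: e2.
- by rewrite {1}e3; apply: eq_bigr => i _; rewrite ge0_ReK.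
Qed.

Lemma ln_concave (s x y : R) : 0 <= s <= 1 -> 0 < x -> 0 < y ->
  s * ln x + (1 - s) * ln y <= ln (s * x + (1 - s) * y).
Proof.
move=> s01 x0 y0; have := @concave_ln R (Itv01 (andP s01).1 (andP s01).2) x y x0 y0.
by rewrite !convRE.
Qed.

Lemma ln_prod n (u : 'I_n -> R) : (forall i, 0 < u i) ->
  ln (\prod_i u i) = \sum_i ln (u i).
Proof.
move=> u0; suff [] : 0 < \prod_i u i /\ ln (\prod_i u i) = \sum_i ln (u i) by [].
elim/big_ind2: _ => [|x1 x2 y1 y2 [x0 xE] [y0 yE]|//]; first by rewrite ln1.
by rewrite mulr_gt0// lnM ?posrE// xE yE.
Qed.

(** The pencil formula writes every determinant on the segment as det X times a product of s + (1 -
    s) u_i; after taking logarithms only scalar concavity remains. *)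
Lemma logdet_concave n (X Y : 'M[C]_n) (s : R) : 0 <= s <= 1 ->
  psd X -> psd Y -> 0 < \det X -> 0 < \det Y ->
  s * ln (complex.Re (\det X)) + (1 - s) * ln (complex.Re (\det Y)) <=
  ln (complex.Re (\det (s%:C *: X + (1 - s)%:C *: Y))).
Proof.
move=> s01 pX pY dX dY.
have [v v0 dE] := hermpsd_pencil_det pX pY (lt0r_neq0 dX).
pose u i := complex.Re (v i).
have u0 i : 0 <= u i by exact: Re_ge0.
have {}dE (a b : R) : \det (a%:C *: X + b%:C *: Y) =
    (complex.Re (\det X) * \prod_i (a + b * u i))%:C.
  rewrite dE rmorphM/= ge0_ReK ?ltW// rmorph_prod; congr (_ * _).
  by apply: eq_bigr => i _; rewrite rmorphD rmorphM/= ge0_ReK.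
have dXr := Re_gt0 dX.
(* At the endpoint Y the pencil gives det Y = det X times the product of the u_i; since det Y > 0,
   no u_i vanishes. *)
have := dE 0 1; rewrite rmorph0 rmorph1 scale0r scale1r add0r.
under eq_bigr do rewrite add0r mul1r.
move=> deY; have := Re_gt0 dY; rewrite deY/= pmulr_rgt0// => pu.
have u1 i : 0 < u i.
  rewrite lt_neqAle u0 andbT eq_sym; apply: contraTneq pu => ui0.
  by rewrite (bigD1 i)//= ui0 mul0r ltxx.
have s0 i : 0 < s + (1 - s) * u i.
  have [<-|s1] := eqVneq 1 s; first by rewrite subrr mul0r addr0.
  by rewrite ltr_wpDl ?(andP s01).1// mulr_gt0// subr_gt0 lt_neqAle eq_sym s1 (andP s01).2.
rewrite dE/= !lnM ?posrE ?prodr_gt0// !ln_prod//.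
(* Concavity of ln between 1 and u_i, where ln 1 = 0. *)
have : \sum_i (1 - s) * ln (u i) <= \sum_i ln (s + (1 - s) * u i).
  apply: ler_sum => i _; have := ln_concave s01 (ltr01 : 0 < 1 :> R) (u1 i).
  by rewrite ln1 mulr0 add0r mulr1.
by rewrite -mulr_sumr => h; lra.
Qed.

Lemma det1D_psd_gt0 n (M : 'M[C]_n) : psd M -> 0 < \det (1%:M + M).
Proof.
move=> /psdE/hermpsd_det[u u0 dE]; have := dE 1 1.
rewrite !scale1r => ->; apply: prodr_gt0 => i _.
by rewrite mul1r ltr_pwDl.
Qed.

End ComplexMatrixTheory.

(** * Integrals of complex and matrix-valued functions on the real line *)

Section Integrals.
Set Implicit Arguments.
Unset Strict Implicit.
Context {R : realType}.
Local Notation C := R[i].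
Local Notation mu := (@lebesgue_measure R).
Implicit Types (f g h : R -> R).

(** A class of multipliers that preserves integrability and is closed under sums and products; the
    steering entries and their derivatives fall into it. *)
Definition bounded_continuous f := continuous f /\ exists M, forall x, `|f x| <= M.

Lemma bounded_continuous_cst (c : R) : bounded_continuous (fun=> c).
Proof. by split; [move=> x; exact: cvg_cst|exists `|c|]. Qed.

Lemma bounded_continuousD f g : bounded_continuous f -> bounded_continuous g ->
  bounded_continuous (fun x => f x + g x).
Proof.
move=> [cf [M fM]] [cg [N gN]]; split; first by move=> x; apply: cvgD; [exact: cf|exact: cg].
by exists (M + N) => x; apply: le_trans (ler_normD _ _) _; exact: lerD.
Qed.

Lemma bounded_continuousM f g : bounded_continuous f -> bounded_continuous g ->
  bounded_continuous (fun x => f x * g x).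
Proof.
move=> [cf [M fM]] [cg [N gN]]; split; first by move=> x; apply: cvgM; [exact: cf|exact: cg].
by exists (M * N) => x; rewrite normrM; exact: ler_pM.
Qed.

Lemma bounded_continuousN f : bounded_continuous f -> bounded_continuous (fun x => - f x).
Proof.
move=> [cf [M fM]]; split; first by move=> x; apply: cvgN; exact: cf.
by exists M => x; rewrite normrN.
Qed.

Lemma bounded_continuous_integrable f g : bounded_continuous f ->
  mu.-integrable setT (EFin \o g) -> mu.-integrable setT (EFin \o (fun x => g x * f x)).
Proof.
move=> [cf [M fM]] ig.
have -> : EFin \o (fun x => g x * f x) = ((EFin \o g) \* (EFin \o f))%E.
  by apply/funext => x.
apply: integrableMl => //; first exact: continuous_measurable_fun.
exists M; split; first exact: num_real.
by move=> y My x _; apply: le_trans (fM x) (ltW My).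
Qed.

(** Near x0 the function exceeds half its value there, so it dominates a positive multiple of the
    indicator of an interval. *)
Lemma continuous_Rintegral_gt0 g (x0 : R) : continuous g -> (forall x, 0 <= g x) ->
  mu.-integrable setT (EFin \o g) -> 0 < g x0 -> 0 < \int[mu]_x g x.
Proof.
move=> cg g0 ig gx0.
have h2 : 0 < g x0 / 2 by lra.
have /nbhs_ballP[e /= e0 He] : \forall y \near x0, `|g x0 - g y| < g x0 / 2.
  by move/cvgrPdist_lt : (cg x0); exact.
(* Half the radius puts the closed interval inside the open ball. *)
pose I := `[x0 - e / 2, x0 + e / 2]%classic.
have gI y : I y -> g x0 / 2 <= g y.
  rewrite /I/= in_itv/= => /andP[y1 y2].
  have := He y; rewrite /ball/= => /(_ _)/wrap[|].
    by rewrite ltr_norml; apply/andP; split; lra.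
  by rewrite ltr_norml => /andP[]; lra.
have ii : mu.-integrable setT (EFin \o (fun y => g x0 / 2 * \1_I y)).
  exact: (integrableZl measurableT (g x0 / 2) (integrable_indic_itv _ _ _ _)).
apply: (@lt_le_trans _ _ (\int[mu]_y (g x0 / 2 * \1_I y))); last first.
  apply: le_Rintegral => // y _; rewrite indicE.
  by have [/set_mem/gI|] := boolP (y \in I); rewrite ?mulr1// mulr0 g0.
rewrite RintegralZl//; last exact: integrable_indic_itv.
have mI : measurable I by exact: measurable_itv.
rewrite /Rintegral integral_indic// setIT/= /I lebesgue_measure_itv/= lte_fin ifT; last lra.
by rewrite -EFinB/= mulr_gt0//; lra.
Qed.

Definition cintegrable (f : R -> C) :=
  mu.-integrable setT (EFin \o (fun x => complex.Re (f x))) /\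
  mu.-integrable setT (EFin \o (fun x => complex.Im (f x))).

Lemma integrableRD f g : mu.-integrable setT (EFin \o f) ->
  mu.-integrable setT (EFin \o g) ->
  mu.-integrable setT (EFin \o (fun x => f x + g x)).
Proof. exact: integrableD. Qed.

Lemma integrableRB f g : mu.-integrable setT (EFin \o f) ->
  mu.-integrable setT (EFin \o g) ->
  mu.-integrable setT (EFin \o (fun x => f x - g x)).
Proof. exact: integrableB. Qed.

Lemma integrableRZ (c : R) f : mu.-integrable setT (EFin \o f) ->
  mu.-integrable setT (EFin \o (fun x => c * f x)).
Proof. by move=> /(integrableZl measurableT c). Qed.

Lemma complex_ReD (x y : C) : complex.Re (x + y) = complex.Re x + complex.Re y.
Proof. by case: x y => ? ? []. Qed.

Lemma complex_ImD (x y : C) : complex.Im (x + y) = complex.Im x + complex.Im y.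
Proof. by case: x y => ? ? []. Qed.

Lemma complex_ReM (x y : C) : complex.Re (x * y) =
  complex.Re x * complex.Re y - complex.Im x * complex.Im y.
Proof. by case: x y => ? ? []. Qed.

Lemma complex_ImM (x y : C) : complex.Im (x * y) =
  complex.Re x * complex.Im y + complex.Im x * complex.Re y.
Proof. by case: x y => ? ? []. Qed.

Lemma complex_Re_conj (x : C) : complex.Re (Num.conj x) = complex.Re x.
Proof. by case: x. Qed.

Lemma complex_Im_conj (x : C) : complex.Im (Num.conj x) = - complex.Im x.
Proof. by case: x. Qed.

Lemma cintegrableD (f g : R -> C) : cintegrable f -> cintegrable g ->
  cintegrable (fun x => f x + g x).
Proof.
move=> [f1 f2] [g1 g2]; split.
  by under eq_fun do rewrite complex_ReD; exact: integrableRD.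
by under eq_fun do rewrite complex_ImD; exact: integrableRD.
Qed.

Lemma cintegralD (f g : R -> C) : cintegrable f -> cintegrable g ->
  cintegral (fun x => f x + g x) = cintegral f + cintegral g.
Proof.
move=> [f1 f2] [g1 g2]; rewrite /cintegral; simpc; congr (_ +i* _).
  by under eq_Rintegral do rewrite complex_ReD; rewrite RintegralD.
by under eq_Rintegral do rewrite complex_ImD; rewrite RintegralD.
Qed.

Lemma cintegrableZ (c : C) (f : R -> C) : cintegrable f ->
  cintegrable (fun x => c * f x).
Proof.
move=> [f1 f2]; split.
  under eq_fun do rewrite complex_ReM.
  by apply: integrableRB; exact: integrableRZ.
under eq_fun do rewrite complex_ImM.
by apply: integrableRD; exact: integrableRZ.
Qed.

Lemma cintegralZ (c : C) (f : R -> C) : cintegrable f ->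
  cintegral (fun x => c * f x) = c * cintegral f.
Proof.
move=> [f1 f2]; case: c => a b; rewrite /cintegral; simpc; congr (_ +i* _).
  under eq_Rintegral do rewrite complex_ReM/=.
  by rewrite RintegralB ?RintegralZl//; exact: integrableRZ.
under eq_Rintegral do rewrite complex_ImM/=.
by rewrite RintegralD ?RintegralZl//; exact: integrableRZ.
Qed.

Lemma cintegrable0 : cintegrable (fun=> 0).
Proof. by split; exact: integrable0. Qed.

Lemma cintegral0 : cintegral (fun _ : R => 0 : C) = 0.
Proof.
by rewrite /cintegral/= !Rintegral_cst// !mul0r.
Qed.

Lemma cintegrable_sum (I : Type) (r : seq I) (F : I -> R -> C) :
  (forall i, cintegrable (F i)) -> cintegrable (fun x => \sum_(i <- r) F i x).
Proof.
move=> iF; elim: r => [|i r ih].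
  by under eq_fun do rewrite big_nil; exact: cintegrable0.
by under eq_fun do rewrite big_cons; exact: cintegrableD.
Qed.

Lemma cintegral_sum (I : Type) (r : seq I) (F : I -> R -> C) :
  (forall i, cintegrable (F i)) ->
  cintegral (fun x => \sum_(i <- r) F i x) = \sum_(i <- r) cintegral (F i).
Proof.
move=> iF; elim: r => [|i r ih].
  by under eq_fun do rewrite big_nil; rewrite cintegral0 big_nil.
under eq_fun do rewrite big_cons.
by rewrite cintegralD// ?ih ?big_cons//; exact: cintegrable_sum.
Qed.

Lemma cintegral_conj (f : R -> C) : cintegrable f ->
  cintegral (fun x => Num.conj (f x)) = Num.conj (cintegral f).
Proof.
move=> [f1 f2]; apply/eqP; rewrite eq_complex complex_Re_conj complex_Im_conj/=.
apply/andP; split; apply/eqP.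
  by under eq_Rintegral do rewrite complex_Re_conj.
under eq_Rintegral do rewrite complex_Im_conj -mulN1r.
by rewrite RintegralZl// mulN1r.
Qed.

Lemma cintegrable_conj (f : R -> C) : cintegrable f ->
  cintegrable (fun x => Num.conj (f x)).
Proof.
move=> [f1 f2]; split; first by under eq_fun do rewrite complex_Re_conj.
under eq_fun do rewrite complex_Im_conj -mulN1r.
exact: integrableRZ.
Qed.

Lemma cintegral_real (f : R -> R) : cintegral (fun x => (f x)%:C) = (\int[mu]_x f x)%:C.
Proof.
by rewrite /cintegral/= Rintegral_cst// mul0r.
Qed.

Lemma cintegral_ge0 (f : R -> C) : (forall x, 0 <= f x) -> 0 <= cintegral f.
Proof.
move=> f0; have -> : f = (fun x => (complex.Re (f x))%:C).
  by apply/funext => x; rewrite ge0_ReK.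
by rewrite cintegral_real ler0c; apply: Rintegral_ge0 => x _; exact: Re_ge0.
Qed.

(** Cauchy-Schwarz under the integral: for each fixed z the pointwise inequality is integrated term
    by term, and only then is z chosen. *)
Lemma cintegral_schur (N : C) (q2 q3 q4 : R -> C) :
  0 < N -> cintegrable q2 -> cintegrable q3 -> cintegrable q4 -> 0 < cintegral q4 ->
  (forall z x, 0 <= q2 x + (- Num.conj z * q3 x + (- z * Num.conj (q3 x)
     + z * Num.conj z * q4 x))) ->
  `|N * cintegral q3| ^+ 2 / (N * cintegral q4) <= N * cintegral q2.
Proof.
move=> N0 i2 i3 i4 c40 pos; apply: (schur_min N0 c40) => z.
have i3c := cintegrable_conj i3.
have j3 := cintegrableZ (- Num.conj z) i3.
have j3c := cintegrableZ (- z) i3c.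
have j4 := cintegrableZ (z * Num.conj z) i4.
have j34 := cintegrableD j3c j4; have j334 := cintegrableD j3 j34.
have := cintegral_ge0 (pos z).
rewrite (cintegralD i2 j334) (cintegralD j3 j34) (cintegralD j3c j4).
rewrite (cintegralZ _ i3) (cintegralZ _ i3c) (cintegralZ _ i4) (cintegral_conj i3).
exact: id.
Qed.

(** The trace against W is a finite linear combination of entries, so it commutes with the entrywise
    integral. *)
Lemma mxtrace_mxintegral n (F : R -> 'M[C]_n) (W : 'M[C]_n) :
  (forall i j, cintegrable (fun x => F x i j)) ->
  \tr (mxintegral F *m W) = cintegral (fun x => \tr (F x *m W)) /\
  cintegrable (fun x => \tr (F x *m W)).
Proof.
move=> iF.
have iF' i j : cintegrable (fun x => W j i * F x i j) by exact: cintegrableZ.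
have eF : (fun x => \tr (F x *m W)) = (fun x => \sum_i \sum_j W j i * F x i j).
  apply/funext => x; apply: eq_bigr => i _; rewrite mxE.
  by apply: eq_bigr => j _; rewrite mulrC.
rewrite eF; split; last by do 2 (apply: cintegrable_sum => ?).
rewrite cintegral_sum; last by move=> i; exact: cintegrable_sum.
apply: eq_bigr => i _; rewrite mxE cintegral_sum//.
by apply: eq_bigr => j _; rewrite mxE cintegralZ// mulrC.
Qed.

End Integrals.

(** * Fisher information of a single Gaussian *)

Section GaussianMixture.
Set Implicit Arguments.
Unset Strict Implicit.
Context {R : realType}.
Local Notation mu := (@lebesgue_measure R).

Lemma is_derive_normal_pdf (m s x : R) : s != 0 ->
  is_derive x 1 (normal_pdf m s) (- (normal_pdf m s x * ((x - m) / s ^+ 2))).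
Proof.
move=> s0; rewrite normal_pdfE// /normal_fun.
apply: is_derive_eq; rewrite /GRing.scale/=.
set e := expR _; field; exact: s0.
Qed.

Lemma normal_pdf_gt0 (m s x : R) : s != 0 -> 0 < normal_pdf m s x.
Proof. by move=> s0; rewrite normal_pdfE// mulr_gt0 ?expR_gt0// normal_peak_gt0. Qed.

Lemma continuous_score_pow (m s : R) k : s != 0 ->
  continuous (fun x => normal_pdf m s x * ((x - m) / s ^+ 2) ^+ k).
Proof.
move=> s0 x; apply: cvgM; first exact: continuous_normal_pdf.
apply: (@cvg_comp _ _ _ (fun x => (x - m) / s ^+ 2) (fun y => y ^+ k)); last exact: exprn_continuous.
by apply: cvgM; [apply: cvgB; [exact: cvg_id|exact: cvg_cst]|exact: cvg_cst].
Qed.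

(* Integration by parts on [m - r, m + r]: the boundary terms have the favourable sign,
   so that they need not be shown to vanish. *)
Lemma normal_fisher_itv_le (m s r : R) : s != 0 -> 0 < r ->
  (\int[mu]_(x in `[(m - r)%R, (m + r)%R]) (normal_pdf m s x * ((x - m) / s ^+ 2) ^+ 2)%R%:E
   <= (s ^- 2)%:E)%E.
Proof.
move=> s0 r0.
have ab : m - r < m + r by lra.
(* F is the derivative of the density and h its second derivative; the integrand is h plus s^-2
   times the density. *)
pose F x := - (normal_pdf m s x * ((x - m) / s ^+ 2)).
pose h x := normal_pdf m s x * ((x - m) / s ^+ 2) ^+ 2 - s ^- 2 * normal_pdf m s x.
have ds : s ^+ 2 != 0 by rewrite expf_neq0.
have dF (x : R) : is_derive x 1 F (h x).
  rewrite /F /h; have ? := is_derive_normal_pdf m x s0.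
  apply: is_derive_eq; rewrite /GRing.scale/=; field; exact: s0.
have dF' (x : R) : derivable F x 1 by [].
have cF : continuous F.
  by move=> x; apply/differentiable_continuous/derivable1_diffP.
have cn := @continuous_normal_pdf _ m s s0.
have cg := @continuous_score_pow m s 2 s0.
have ch : continuous h.
  by move=> x; apply: cvgB; [exact: cg|apply: cvgM; [exact: cvg_cst|exact: cn]].
have int f : continuous f -> mu.-integrable `[m - r, m + r] (EFin \o f).
  move=> cf; apply: continuous_compact_integrable; first exact: segment_compact.
  exact: continuous_subspaceT.
have := @continuous_FTC2 _ h F _ _ ab (continuous_subspaceT ch).
move=> /(_ _ _)/wrap[||].
- split; first by move=> x _.
    by apply: cvg_at_right_filter; exact: cF.
  by apply: cvg_at_left_filter; exact: cF.
- by move=> x _; rewrite derive1E derive_val.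
move=> e.
have -> : (fun x => (normal_pdf m s x * ((x - m) / s ^+ 2) ^+ 2)%:E) =
    (fun x => ((h x)%:E + (s ^- 2 * normal_pdf m s x)%R%:E)%E).
  by apply/funext => x; rewrite -EFinD /h subrK.
rewrite integralD//; [|exact: (int h)|apply: (int (fun x => _ * _))]; last first.
  by move=> x; apply: cvgM; [exact: cvg_cst|exact: cn].
rewrite e -[leRHS]add0e leeD//.
  rewrite -EFinB lee_fin /F.
  have -> : m + r - m = r by ring.
  have -> : m - r - m = - r by ring.
  rewrite mulNr mulrN opprK -opprD oppr_le0.
  by rewrite addr_ge0// mulr_ge0 ?normal_pdf_ge0// divr_ge0 ?sqr_ge0// ltW.
under eq_integral do rewrite EFinM.
rewrite integralZl//; last exact: (int (normal_pdf m s)).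
rewrite -[leRHS]mule1; apply: lee_wpmul2l; first by rewrite lee_fin invr_ge0 sqr_ge0.
rewrite -(integral_normal_pdf m s); apply: ge0_subset_integral => //.
- by apply/measurable_EFinP; exact: measurable_normal_pdf.
- by move=> x _; rewrite lee_fin normal_pdf_ge0.
Qed.

(** Monotone convergence along growing symmetric intervals carries the bound to the whole line;
    finiteness then gives integrability. *)
Lemma normal_fisher (m s : R) : s != 0 ->
  let g x := normal_pdf m s x * ((x - m) / s ^+ 2) ^+ 2 in
  mu.-integrable setT (EFin \o g) /\ \int[mu]_x g x <= s ^- 2.
Proof.
move=> s0 g.
have cg : continuous g by exact: continuous_score_pow.
have mg : measurable_fun setT g by exact: continuous_measurable_fun.
have g0 x : 0 <= g x by rewrite mulr_ge0 ?normal_pdf_ge0// sqr_ge0.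
(* The successor keeps the radius positive, as [normal_fisher_itv_le] requires. *)
pose I (n : nat) := `[m - n.+1%:R, m + n.+1%:R]%classic.
have UI : \bigcup_n I n = setT.
  apply/seteqP; split=> // x _.
  exists (Num.bound `|x - m|) => //=; rewrite /I/= in_itv/=.
  have := archi_boundP (normr_ge0 (x - m)); rewrite ltr_norml -natr1.
  by move=> /andP[? ?]; apply/andP; split; lra.
have le : (\int[mu]_x (g x)%:E <= (s ^- 2)%:E)%E.
  rewrite -UI.
  have := @ge0_nondecreasing_set_cvg_integral _ (measurableTypeR R) R I (EFin \o g) mu.
  move=> /(_ _ _ _ _)/wrap[||||].
  - move=> a b ab; apply/subsetPset => x; rewrite /I/= !in_itv/= => /andP[].
    have : a.+1%:R <= b.+1%:R :> R by rewrite ler_nat.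
    by move=> *; apply/andP; split; lra.
  - by move=> n; exact: measurable_itv.
  - by move=> n; apply/measurable_EFinP; exact: measurable_funS mg.
  - by move=> n x _; rewrite lee_fin.
  move=> c; apply: (cvge_le _ c); apply: nearW => n /=.
  exact: normal_fisher_itv_le.
have ig : mu.-integrable setT (EFin \o g).
  apply/integrableP; split; first exact/measurable_EFinP.
  under eq_integral do rewrite /= ger0_norm//.
  by apply: le_lt_trans le _; rewrite ltry.
split => //; rewrite -lee_fin /Rintegral fineK//.
exact: integrable_fin_num.
Qed.

(** * Prior information of the Gaussian mixture *)

Context (S : system R).
Hypothesis hp : forall k : 'I_(K S), 0 <= weight k <= 1.
Hypothesis hp1 : \sum_(k < K S) weight k = 1.
Hypothesis hsigma : forall k : 'I_(K S), 0 < stdev k.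

Let s0 (k : 'I_(K S)) : stdev k != 0. Proof. exact/lt0r_neq0/hsigma. Qed.
Let w0 (k : 'I_(K S)) : 0 <= weight k. Proof. by have /andP[] := hp k. Qed.

Lemma exists_weight_gt0 : exists k : 'I_(K S), 0 < weight k.
Proof.
apply: contrapT => n; have : \sum_(k < K S) weight k = 0.
  apply: big1 => k _; apply/eqP; rewrite eq_le w0 andbT leNgt.
  by apply/negP => ?; apply: n; exists k.
by rewrite hp1 => /eqP; rewrite oner_eq0.
Qed.

Lemma prior_gt0 x : 0 < prior S x.
Proof.
have [k k0] := exists_weight_gt0; rewrite /prior (bigD1 k)//= ltr_pwDl//.
  by rewrite mulr_gt0// normal_pdf_gt0.
by apply: sumr_ge0 => i _; rewrite mulr_ge0// normal_pdf_ge0.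
Qed.

Lemma continuous_sum (I : Type) (r : seq I) (F : I -> R -> R) :
  (forall i, continuous (F i)) -> continuous (fun x => \sum_(i <- r) F i x).
Proof.
move=> cF x; elim: r => [|i r ih].
  by under eq_fun do rewrite big_nil; exact: cvg_cst.
by under eq_fun do rewrite big_cons; apply: cvgD => //; exact: cF.
Qed.

Lemma integrableR_sum (I : Type) (r : seq I) (F : I -> R -> R) :
  (forall i, mu.-integrable setT (EFin \o F i)) ->
  mu.-integrable setT (EFin \o (fun x => \sum_(i <- r) F i x)).
Proof.
move=> iF; elim: r => [|i r ih].
  by under eq_fun do rewrite big_nil; exact: integrable0.
by under eq_fun do rewrite big_cons; exact: integrableRD.
Qed.

Lemma Rintegral_sum (I : Type) (r : seq I) (F : I -> R -> R) :
  (forall i, mu.-integrable setT (EFin \o F i)) ->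
  \int[mu]_x (\sum_(i <- r) F i x) = \sum_(i <- r) \int[mu]_x F i x.
Proof.
move=> iF; elim: r => [|i r ih].
  by under eq_Rintegral do rewrite big_nil; rewrite big_nil Rintegral_cst// mul0r.
under eq_Rintegral do rewrite big_cons.
by rewrite big_cons RintegralD ?ih//; exact: integrableR_sum.
Qed.

(** Writing M_i for this sum: M_0 is the prior p, M_1 is - p', and M_2 integrates to the weighted
    sum of the component Fisher informations. *)
Definition score_moment i x : R :=
  \sum_(k < K S) weight k * (normal_pdf (mean k) (stdev k) x * ((x - mean k) / stdev k ^+ 2) ^+ i).

Lemma score_moment0 x : score_moment 0 x = prior S x.
Proof. by apply: eq_bigr => k _; rewrite expr0 mulr1. Qed.

Lemma continuous_score_moment i : continuous (score_moment i).
Proof.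
apply: continuous_sum => k x; apply: cvgM; first exact: cvg_cst.
exact: continuous_score_pow.
Qed.

Lemma continuous_prior : continuous (prior S).
Proof.
have -> : prior S = score_moment 0 by apply/funext => x; rewrite score_moment0.
exact: continuous_score_moment.
Qed.

Lemma integrable_prior : mu.-integrable setT (EFin \o prior S).
Proof.
apply: integrableR_sum => k; apply: integrableRZ; exact: integrable_normal_pdf.
Qed.

(** Expanding the square turns the double sum into 2 (M_2 M_0 - M_1^2), which is divided by 2
    M_0. *)
Lemma rho_integrand x :
  (\sum_(k1 < K S) \sum_(k2 < K S) weight k1 * weight k2 * f k1 x * f k2 x *
     ((x - mean k1) / stdev k1 ^+ 2 - (x - mean k2) / stdev k2 ^+ 2) ^+ 2)
     / (2 * \sum_(k < K S) weight k * f k x) =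
  score_moment 2 x - score_moment 1 x ^+ 2 / prior S x.
Proof.
have p0 := lt0r_neq0 (prior_gt0 x).
set N := (X in X / _); suff -> : N = 2 * (score_moment 2 x * prior S x - score_moment 1 x ^+ 2).
  by rewrite -/(prior S x); field.
rewrite -score_moment0 mulrBr; pose T i j := score_moment i x * score_moment j x.
(* Symmetrised so that the identity holds summand by summand in the double sum. *)
have -> : 2 * (score_moment 2 x * score_moment 0 x) - 2 * score_moment 1 x ^+ 2 =
   T 2 0 + T 0 2 - T 1 1 - T 1 1 by rewrite /T; ring.
rewrite /T /score_moment !big_distrlr/= -!(big_split, sumrB)/=.
apply: eq_bigr => k _; rewrite -!(big_split, sumrB)/=; apply: eq_bigr => l _.
by rewrite /f/=; ring.
Qed.

Lemma prior_information_gt0 : 0 < prior_information S.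
Proof.
have i2 : mu.-integrable setT (EFin \o score_moment 2).
  by apply: integrableR_sum => k; apply: integrableRZ; exact: (normal_fisher _ (s0 k)).1.
(* This is (p')^2 / p, the Fisher integrand of the mixture. *)
pose h x := score_moment 1 x ^+ 2 / prior S x.
have h0 x : 0 <= h x by rewrite divr_ge0 ?sqr_ge0// ltW// prior_gt0.
have ch : continuous h.
  move=> x; apply: cvgM.
    by apply: (cvg_comp (score_moment 1) (fun y => y ^+ 2));
      [exact: continuous_score_moment|exact: exprn_continuous].
  apply: cvgV; [exact/lt0r_neq0/prior_gt0|exact: continuous_prior].
(* The difference is the integrand of [rho], a nonnegative quotient. This domination makes h
   integrable, so the integral in [rho] can be split. *)
have hle x : h x <= score_moment 2 x.
  rewrite -subr_ge0 /h -rho_integrand divr_ge0//.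
    apply: sumr_ge0 => k _; apply: sumr_ge0 => l _.
    by rewrite mulr_ge0 ?sqr_ge0// !mulr_ge0// normal_pdf_ge0.
  by rewrite mulr_ge0// ltW// prior_gt0.
have ih : mu.-integrable setT (EFin \o h).
  apply: le_integrable i2 => //.
    by apply/measurable_EFinP; exact: continuous_measurable_fun.
  move=> x _ /=; rewrite lee_fin !ger0_norm//.
  exact: le_trans (hle x).
have -> : prior_information S = \sum_(k < K S) weight k / stdev k ^+ 2 -
    \int[mu]_x score_moment 2 x + \int[mu]_x h x.
  rewrite /prior_information /rho; under eq_Rintegral do rewrite rho_integrand.
  by rewrite RintegralB//; ring.
apply: ltr_wpDl.
  rewrite subr_ge0 Rintegral_sum; last first.
    by move=> k; apply: integrableRZ; exact: (normal_fisher _ (s0 k)).1.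
  apply: ler_sum => k _; rewrite RintegralZl//; last exact: (normal_fisher _ (s0 k)).1.
  by rewrite ler_wpM2l//; exact: (normal_fisher _ (s0 k)).2.
(* A point to the right of every mean: all summands of M_1 are nonnegative there and one is
   positive, so h is positive at x0. *)
pose x0 := \sum_(k < K S) `|mean k| + 1.
have xk (k : 'I_(K S)) : 0 < x0 - mean k.
  rewrite subr_gt0 /x0 (bigD1 k)//= -addrA (le_lt_trans (ler_norm _))// ltrDl.
  rewrite ltr_wpDl//. by apply: sumr_ge0.
apply: (@continuous_Rintegral_gt0 _ h x0) => //.
have [k k0] := exists_weight_gt0.
rewrite /h divr_gt0 ?prior_gt0// exprn_gt0// /score_moment (bigD1 k)//= ltr_pwDl//.
  by rewrite expr1 !mulr_gt0 ?normal_pdf_gt0 ?invr_gt0 ?exprn_gt0.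
by apply: sumr_ge0 => l _; rewrite expr1 !mulr_ge0 ?normal_pdf_ge0// ?invr_ge0 ?sqr_ge0 ?ltW.
Qed.
End GaussianMixture.

(** * Traces of the sensing matrices as integrals against the prior *)

Section SensingMatrices.
Set Implicit Arguments.
Unset Strict Implicit.
Context {R : realType}.
Local Notation C := R[i].
Local Notation mu := (@lebesgue_measure R).

Definition cbounded_continuous (g : R -> C) :=
  bounded_continuous (fun x => complex.Re (g x)) /\
  bounded_continuous (fun x => complex.Im (g x)).

Lemma cbounded_continuous0 : cbounded_continuous (fun=> 0).
Proof. by split; exact: bounded_continuous_cst. Qed.

Lemma cbounded_continuousD (f g : R -> C) : cbounded_continuous f ->
  cbounded_continuous g -> cbounded_continuous (fun x => f x + g x).
Proof.
move=> [f1 f2] [g1 g2]; split.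
  by under eq_fun do rewrite complex_ReD; exact: bounded_continuousD.
by under eq_fun do rewrite complex_ImD; exact: bounded_continuousD.
Qed.

Lemma cbounded_continuousM (f g : R -> C) : cbounded_continuous f ->
  cbounded_continuous g -> cbounded_continuous (fun x => f x * g x).
Proof.
move=> [f1 f2] [g1 g2]; split.
  under eq_fun do rewrite complex_ReM.
  apply: bounded_continuousD; first exact: bounded_continuousM.
  by apply: bounded_continuousN; exact: bounded_continuousM.
under eq_fun do rewrite complex_ImM.
by apply: bounded_continuousD; exact: bounded_continuousM.
Qed.

Lemma cbounded_continuous_conj (f : R -> C) : cbounded_continuous f ->
  cbounded_continuous (fun x => Num.conj (f x)).
Proof.
move=> [f1 f2]; split.
  by under eq_fun do rewrite complex_Re_conj.
by under eq_fun do rewrite complex_Im_conj; exact: bounded_continuousN.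
Qed.

Lemma cbounded_continuous_sum (I : Type) (r : seq I) (F : I -> R -> C) :
  (forall i, cbounded_continuous (F i)) ->
  cbounded_continuous (fun x => \sum_(i <- r) F i x).
Proof.
move=> iF; elim: r => [|i r ih].
  by under eq_fun do rewrite big_nil; exact: cbounded_continuous0.
by under eq_fun do rewrite big_cons; exact: cbounded_continuousD.
Qed.

Lemma cbounded_continuous_integrable (p : R -> R) (g : R -> C) :
  mu.-integrable setT (EFin \o p) -> cbounded_continuous g ->
  cintegrable (fun x => (p x)%:C * g x).
Proof.
move=> ip [g1 g2]; split.
  under eq_fun do rewrite complex_ReM/= mul0r subr0.
  exact: bounded_continuous_integrable.
under eq_fun do rewrite complex_ImM/= mul0r addr0.
exact: bounded_continuous_integrable.
Qed.

Lemma bounded_continuous_sin_cos (c : R) :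
  bounded_continuous (fun x => cos (c * sin x)) /\
  bounded_continuous (fun x => sin (c * sin x)).
Proof.
have cs : continuous (fun x : R => c * sin x).
  by move=> x; apply: cvgM; [exact: cvg_cst|exact: continuous_sin].
split; split.
- by move=> x; apply: (cvg_comp _ _ (cs x)); exact: continuous_cos.
- by exists 1 => x; rewrite ler_norml cos_geN1 cos_le1.
- by move=> x; apply: (cvg_comp _ _ (cs x)); exact: continuous_sin.
- by exists 1 => x; rewrite ler_norml sin_geN1 sin_le1.
Qed.

Lemma bounded_continuous_cos : bounded_continuous (@cos R).
Proof.
split; first exact: continuous_cos.
by exists 1 => x; rewrite ler_norml cos_geN1 cos_le1.
Qed.

Context (S : system R).

(** The angle-free factor of the exponent: the steering entry is exp(- j phase sin x). *)
Definition phase (N k : nat) : R :=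
  pi * spacing S * (N%:R - 2 * k.+1%:R + 1) * cos_phi S / wavelength S.

Lemma steeringE N x (k : 'I_N) : steering S N x k 0 =
  cos (phase N k * sin x) -i* sin (phase N k * sin x).
Proof.
rewrite mxE /=; suff -> : phase N k * sin x = pi * spacing S *
  (N%:R - 2 * k.+1%:R + 1) * cos_phi S * sin x / wavelength S by [].
by rewrite /phase mulrAC.
Qed.

Lemma mxderive_steeringE N x (k : 'I_N) : mxderive (steering S N) x k 0 =
  (- sin (phase N k * sin x) * (phase N k * cos x)) -i*
  (cos (phase N k * sin x) * (phase N k * cos x)).
Proof.
rewrite mxE; congr (_ +i* _); rewrite derive1E.
  under eq_fun do rewrite steeringE/=.
  exact: derive_val.
under eq_fun do rewrite steeringE/=.
exact: derive_val.
Qed.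

Lemma cbounded_continuous_steering N (k : 'I_N) :
  cbounded_continuous (fun x => steering S N x k 0).
Proof.
have [h1 h2] := bounded_continuous_sin_cos (phase N k).
by split; under eq_fun do rewrite steeringE/=; last apply: bounded_continuousN.
Qed.

Lemma cbounded_continuous_mxderive_steering N (k : 'I_N) :
  cbounded_continuous (fun x => mxderive (steering S N) x k 0).
Proof.
have [h1 h2] := bounded_continuous_sin_cos (phase N k).
have h3 := bounded_continuous_cos.
split; under eq_fun do rewrite mxderive_steeringE/=.
  apply: bounded_continuousM; first exact: bounded_continuousN.
  by apply: bounded_continuousM => //; exact: bounded_continuous_cst.
apply: bounded_continuousN; apply: bounded_continuousM => //.
by apply: bounded_continuousM => //; exact: bounded_continuous_cst.
Qed.


Hypothesis hNr : (0 < Nr S)%N.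
Hypothesis hp : forall k : 'I_(K S), 0 <= weight k <= 1.
Hypothesis hp1 : \sum_(k < K S) weight k = 1.
Hypothesis hsigma : forall k : 'I_(K S), 0 < stdev k.

Let p x : C := (prior S x)%:C.

Let p_ge0 x : 0 <= p x.
Proof. by rewrite ler0c ltW// prior_gt0. Qed.

Let prior_cintegrable (g : R -> C) : cbounded_continuous g ->
  cintegrable (fun x => p x * g x).
Proof. by move=> ?; apply: cbounded_continuous_integrable => //; exact: integrable_prior. Qed.

Let cbc_outer (v w : R -> 'cV[C]_(Nt S)) :
  (forall k, cbounded_continuous (fun x => v x k 0)) ->
  (forall k, cbounded_continuous (fun x => w x k 0)) ->
  forall i j, cbounded_continuous (fun x => (v x *m (w x)^t*) i j).
Proof.
move=> cv cw i j; under eq_fun do rewrite mxE big_ord1 !mxE.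
by apply: cbounded_continuousM => //; exact: cbounded_continuous_conj.
Qed.

Let cbc_a k : cbounded_continuous (fun x => a S x k 0).
Proof. exact: cbounded_continuous_steering. Qed.
Let cbc_a' k : cbounded_continuous (fun x => a' S x k 0).
Proof. exact: cbounded_continuous_mxderive_steering. Qed.

(** With v and w free, one statement covers the integrals in [A2], [A3] and [A4]. *)
Let trace_outer (v w : R -> 'cV[C]_(Nt S)) (W : 'M[C]_(Nt S)) :
  (forall k, cbounded_continuous (fun x => v x k 0)) ->
  (forall k, cbounded_continuous (fun x => w x k 0)) ->
  \tr (mxintegral (fun x => p x *: (v x *m (w x)^t*)) *m W) =
    cintegral (fun x => p x * ((w x)^t* *m W *m v x) 0 0) /\
  cintegrable (fun x => p x * ((w x)^t* *m W *m v x) 0 0).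
Proof.
move=> cv cw.
have -> : (fun x => p x * ((w x)^t* *m W *m v x) 0 0) =
    (fun x => \tr ((p x *: (v x *m (w x)^t*)) *m W)).
  by apply/funext => x; rewrite -scalemxAl mxtraceZ mxtrace_rank1.
apply: mxtrace_mxintegral => i j; under eq_fun do rewrite mxE.
exact/prior_cintegrable/cbc_outer.
Qed.

Lemma mxtrace_A4 (W : 'M[C]_(Nt S)) : \tr (A4 S *m W) =
  (Nr S)%:R * cintegral (fun x => p x * ((a S x)^t* *m W *m a S x) 0 0).
Proof. by rewrite /A4 -scalemxAl mxtraceZ (trace_outer _ cbc_a cbc_a).1. Qed.

Lemma cbounded_continuous_form (W : 'M[C]_(Nt S)) :
  cbounded_continuous (fun x => ((a S x)^t* *m W *m a S x) 0 0).
Proof.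
have -> : (fun x => ((a S x)^t* *m W *m a S x) 0 0) =
    (fun x => \sum_i \sum_j (a S x *m (a S x)^t*) i j * W j i).
  apply/funext => x; rewrite -mxtrace_rank1; apply: eq_bigr => i _.
  by rewrite mxE.
apply: cbounded_continuous_sum => i; apply: cbounded_continuous_sum => j.
apply: cbounded_continuousM; first exact: cbc_outer.
by split; exact: bounded_continuous_cst.
Qed.

Lemma cintegrable_form (W : 'M[C]_(Nt S)) :
  cintegrable (fun x => p x * ((a S x)^t* *m W *m a S x) 0 0).
Proof. exact: (trace_outer W cbc_a cbc_a).2. Qed.

Lemma mxtrace_A2_ge0 (W : 'M[C]_(Nt S)) : psd W -> 0 <= \tr (A2 S *m W).
Proof.
move=> [_ pW]; rewrite /A2 -scalemxAl mxtraceZ (trace_outer _ cbc_a' cbc_a').1.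
by rewrite mulr_ge0// cintegral_ge0// => x; rewrite mulr_ge0.
Qed.

Lemma mxtrace_A1_ge0 (W : 'M[C]_(Nt S)) : psd W -> 0 <= \tr (A1 S *m W).
Proof.
move=> [_ pW]; pose F x := (\sum_m `|b' S x m 0| ^+ 2) *: (p x *: (a S x *m (a S x)^t*)).
have iF i j : cintegrable (fun x => F x i j).
  (* Squared moduli become products with conjugates, under which bounded continuous functions are
     stable. *)
  have -> : (fun x => F x i j) = (fun x => p x *
      ((\sum_m b' S x m 0 * Num.conj (b' S x m 0)) * (a S x *m (a S x)^t*) i j)).
    apply/funext => x; rewrite /F mxE [in LHS]mxE mulrCA; congr (_ * (_ * _)).
    by apply: eq_bigr => m _; rewrite normCK.
  apply: prior_cintegrable; apply: cbounded_continuousM; last exact: cbc_outer.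
  apply: cbounded_continuous_sum => m.
  have cb : cbounded_continuous (fun x => b' S x m 0).
    exact: cbounded_continuous_mxderive_steering.
  by apply: cbounded_continuousM => //; exact: cbounded_continuous_conj.
rewrite /A1 (mxtrace_mxintegral W iF).1.
apply: cintegral_ge0 => x; rewrite /F -!scalemxAl !mxtraceZ mxtrace_rank1.
rewrite mulr_ge0// ?mulr_ge0//.
by apply: sumr_ge0 => m _; rewrite exprn_ge0.
Qed.

(* Nonnegativity of the quadratic form of W at a' - z a, integrated against the prior, for the
   minimising z = tr (A3 W) / tr (A4 W). *)
Lemma mxtrace_A3_le (W : 'M[C]_(Nt S)) : psd W -> 0 < \tr (A4 S *m W) ->
  `|\tr (A3 S *m W)| ^+ 2 / \tr (A4 S *m W) <= \tr (A2 S *m W).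
Proof.
move=> pW.
have N0 : 0 < (Nr S)%:R :> C by rewrite ltr0n.
have trZ (A : 'M[C]_(Nt S)) c : \tr (A *m W) = c ->
    \tr ((Nr S)%:R *: A *m W) = (Nr S)%:R * c by rewrite -scalemxAl mxtraceZ => ->.
have [e4 i4] := trace_outer W cbc_a cbc_a.
have [e3 i3] := trace_outer W cbc_a' cbc_a.
have [e2 i2] := trace_outer W cbc_a' cbc_a'.
have schur (x2 x3 x4 y2 y3 y4 : C) : x2 = y2 -> x3 = y3 -> x4 = y4 ->
    (0 < y4 -> `|y3| ^+ 2 / y4 <= y2) -> 0 < x4 -> `|x3| ^+ 2 / x4 <= x2.
  by move=> -> -> ->.
apply: (schur _ _ _ _ _ _ (trZ _ _ e2) (trZ _ _ e3) (trZ _ _ e4)).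
rewrite (pmulr_rgt0 _ N0) => c40; apply: (cintegral_schur N0 i2 i3 i4 c40) => z x.
exact: (@hermpsd_form_expand _ _ W (a' S x) (a S x) (p x) z pW (p_ge0 x)).
Qed.
End SensingMatrices.

(** * The steering vectors span the whole space *)

Section ArrayManifold.
Set Implicit Arguments.
Unset Strict Implicit.
Context {R : realType}.
Local Notation C := R[i].

Definition cis (t : R) : C := cos t +i* sin t.

Lemma cisD s t : cis (s + t) = cis s * cis t.
Proof. by rewrite /cis sinD cosD; simpc; congr (_ +i* _); ring. Qed.

Lemma cisM_nat t k : cis (t * k%:R) = cis t ^+ k.
Proof.
elim: k => [|k ih]; first by rewrite mulr0 expr0 /cis cos0 sin0.
by rewrite -natr1 mulrDr mulr1 cisD ih exprSr.
Qed.

Lemma cis_neq0 t : cis t != 0.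
Proof.
apply/eqP => h; have := cisD t (- t); rewrite h mul0r subrr /cis cos0 sin0 => /eqP.
by rewrite eq_complex /= oner_eq0.
Qed.

(** A nonzero polynomial of degree below n cannot vanish at n distinct points sampled along the
    arc. *)
Lemma poly_eq0_unit_circle n (v : 'rV[C]_n) (e : R) : 0 < e ->
  (forall t, 0 <= t <= e -> (rVpoly v).[cis (- t)] = 0) -> v = 0.
Proof.
move=> e0 h; apply/eqP; apply: contraT => v0.
have p0 : rVpoly v != 0 by apply: contraNneq v0 => p0; rewrite -[v]rVpolyK p0 linear0.
have n0 : (0 < n)%N.
  by case: n v v0 {p0 h} => // v; rewrite (thinmx0 v) eqxx.
(* The multiples m d with m < n stay in the allowed arc and in [0, pi], where cos is injective and
   so separates the samples. *)
pose d := Num.min e pi / n%:R.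
have d0 : 0 < d by rewrite divr_gt0 ?ltr0n// lt_min e0 pi_gt0.
have md (m : nat) : (m < n)%N -> m%:R * d <= Num.min e pi.
  move=> mn; rewrite /d mulrCA ler_piMr//.
    by rewrite le_min pi_ge0 ltW.
  by rewrite ler_pdivrMr ?ltr0n// mul1r ler_nat ltnW.
pose rs := [seq cis (- (m%:R * d)) | m <- iota 0 n].
have := @max_poly_roots _ (rVpoly v) rs p0.
have -> : all (root (rVpoly v)) rs.
  apply/allP => z /mapP[m]; rewrite mem_iota add0n => /andP[_ mn] ->.
  apply/eqP/h; rewrite mulr_ge0 ?ler0n ?(ltW d0)//=.
  by have := md m mn; rewrite le_min => /andP[].
have -> : uniq rs.
  rewrite map_inj_in_uniq ?iota_uniq// => m1 m2; rewrite !mem_iota !add0n.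
  move=> /andP[_ m1n] /andP[_ m2n] []; rewrite !cosN => hc _.
  have pi_m m : (m < n)%N -> m%:R * d \in `[0, pi].
    move=> mn; rewrite in_itv/= mulr_ge0 ?ler0n ?(ltW d0)//=.
    by have := md m mn; rewrite le_min => /andP[].
  have /mulIf := cos_inj (pi_m _ m1n) (pi_m _ m2n) hc.
  by move=> /(_ (lt0r_neq0 d0))/eqP; rewrite eqr_nat => /eqP.
move=> /(_ isT isT); rewrite size_map size_iota ltnNge => /negP[].
exact: size_poly.
Qed.

Context (S : system R).
Hypothesis (hd : 0 < spacing S) (hlambda : 0 < wavelength S).
Hypothesis (hhB : 0 <= height S) (hr : height S < distance S).

Lemma cos_phi_gt0 : 0 < cos_phi S.
Proof.
have d0 : 0 < distance S by exact: le_lt_trans hr.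
rewrite /cos_phi divr_gt0// sqrtr_gt0 subr_gt0 ltr_pXn2r//.
by rewrite nnegrE ltW.
Qed.

(* The conjugate steering vector is, up to a unit factor, the vector of powers of a point that
   sweeps an arc of the unit circle as the angle varies. *)
Lemma steering_total N (w : 'cV[C]_N) :
  (forall x, ((steering S N x)^t* *m w) 0 0 = 0) -> w = 0.
Proof.
move=> h; pose kappa := pi * spacing S * cos_phi S / wavelength S.
have k0 : 0 < kappa.
  apply: divr_gt0 => //; apply: mulr_gt0; last exact: cos_phi_gt0.
  by apply: mulr_gt0; first exact: pi_gt0.
apply: trmx_inj; rewrite trmx0; apply: (@poly_eq0_unit_circle _ _ (2 * kappa)).
  by rewrite mulr_gt0.
(* The angle is asin s: as its sine runs over [0, 1], t = 2 kappa s covers the arc [0, 2 kappa]. *)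
move=> t /andP[t0 tk]; pose s := t / (2 * kappa).
have s1 : s \in `[-1, 1].
  have kk : 0 < 2 * kappa by exact: mulr_gt0.
  rewrite in_itv/=; apply/andP; split; last by rewrite /s ler_pdivrMr// mul1r.
  by apply: (@le_trans _ _ 0); [rewrite oppr_le0|rewrite divr_ge0// ltW].
have := h (asin s); rewrite mxE.
(* With 0-based j, the phase is kappa (N - 1) - 2 kappa j; the first part factors out and the second
   gives the j-th power of exp(- j t), the j in the exponent being the imaginary unit. *)
have -> : \sum_j (steering S N (asin s))^t* 0 j * w j 0 =
    cis (kappa * s * (N%:R - 1)) * (rVpoly w^T).[cis (- t)].
  rewrite (@horner_coef_wide _ N) ?size_poly// mulr_sumr; apply: eq_bigr => j _.
  rewrite coef_rVpoly_ord mxE mxE steeringE asinK// -cisM_nat.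
  rewrite [w^T 0 j]mxE [RHS]mulrCA -cisD [RHS]mulrC; congr (_ * _).
  have -> : kappa * s * (N%:R - 1) + - t * j%:R = phase S N j * s.
    have -> : t = 2 * kappa * s by rewrite /s mulrC divfK// mulf_neq0 ?lt0r_neq0.
    by rewrite /phase /kappa -natr1; field; exact: lt0r_neq0.
  rewrite /cis; apply/eqP; rewrite eq_complex.
  by rewrite [complex.Re (Num.conj _)]complex_Re_conj
    [complex.Im (Num.conj _)]complex_Im_conj /= opprK !eqxx.
by move=> /eqP; rewrite mulf_eq0 (negbTE (cis_neq0 _)) => /eqP.
Qed.
End ArrayManifold.

(** * Order-theoretic reductions for the optimal values *)

Section Optimization.
Set Implicit Arguments.
Unset Strict Implicit.
Context {R : realType}.
Local Notation C := R[i].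
Local Notation mu := (@lebesgue_measure R).

(** G collects all values below F, so it has the supremum of F. The bound M makes [sup] a genuine
    least upper bound rather than a default value. *)
Lemma inf_inv_affine (T : Type) (D : set T) (F : T -> R) (G : set R) (I s M : R) :
  0 < I -> 0 < s -> D !=set0 -> (forall x, D x -> 0 <= F x <= M) ->
  (forall t, G t <-> exists2 x, D x & t <= F x) ->
  inf [set 1 / (I + s * F x) | x in D] = 1 / (I + s * sup G).
Proof.
move=> I0 s0 [x0 Dx0] F01 GE.
have GF x : D x -> G (F x) by move=> Dx; apply/GE; exists x.
have ubG : has_ubound G.
  exists M => t /GE[x Dx tF]; apply: le_trans tF _.
  by have /andP[] := F01 x Dx.
have FG x : D x -> F x <= sup G by move=> /GF; exact: ub_le_sup.
have den x : D x -> 0 < I + s * F x.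
  by move=> Dx; rewrite ltr_pwDl// mulr_ge0 ?(ltW s0)//; have /andP[] := F01 x Dx.
have denG : 0 < I + s * sup G.
  by apply: lt_le_trans (den x0 Dx0) _; rewrite lerD2l ler_pM2l// FG.
pose A := [set 1 / (I + s * F x) | x in D].
have A0 : A !=set0 by exists (1 / (I + s * F x0)), x0.
have lbA : lbound A (1 / (I + s * sup G)).
  move=> _ [x Dx <-]; rewrite !div1r lef_pV2 ?posrE ?den//.
  by rewrite lerD2l ler_pM2l// FG.
apply/eqP; rewrite eq_le lb_le_inf// andbT.
have infA x : D x -> inf A <= 1 / (I + s * F x).
  by move=> Dx; apply: ge_inf; [exists (1 / (I + s * sup G))|exists x].
have iA0 : 0 < inf A.
  by apply: lt_le_trans (lb_le_inf A0 lbA); rewrite divr_gt0.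
(* Solving for the supremum: it remains that (1 / inf A - I) / s bounds G from above. *)
rewrite ler_pdivlMr// -ler_pdivlMl// mulr1 addrC -lerBrDr -ler_pdivlMl// mulrC.
apply: ge_sup; first by exists (F x0); exact: GF.
move=> t /GE[x Dx tF]; apply: le_trans tF _.
rewrite ler_pdivlMr// mulrC lerBrDr addrC.
by have := infA x Dx; rewrite ler_pdivlMr ?den// -ler_pdivlMl// mulr1.
Qed.

Lemma norm_sqrC (z : C) : (complex.Re `|z| ^+ 2)%:C = `|z| ^+ 2.
Proof. by rewrite rmorphXn; congr (_ ^+ 2); exact: ge0_ReK. Qed.

Lemma schur_le_real (y d x : C) (t : R) : 0 < d -> 0 <= x ->
  (`|y| ^+ 2 / d <= x - t%:C) =
  (t <= complex.Re x - complex.Re `|y| ^+ 2 / complex.Re d).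
Proof.
move=> d0 x0; rewrite -{1}(ge0_ReK (ltW d0)) -{1}(ge0_ReK x0) -norm_sqrC.
rewrite -fmorph_div -rmorphB lecR/=.
by rewrite [LHS]lerBrDr [RHS]lerBrDr addrC.
Qed.

(** * Problems (P1) and (P3): rate, sensing value, equivalence, convexity *)

Context (S : system R).
Hypothesis hNr : (0 < Nr S)%N.
Hypothesis hL : (0 < L S)%N.
Hypothesis hRbar : 0 < rate_threshold S.
Hypothesis hsigma_c : 0 < sigma_c S.
Hypothesis hsigma_s : 0 < sigma_s S.
Hypothesis halpha : alpha S != 0.
Hypothesis hd : 0 < spacing S.
Hypothesis hlambda : 0 < wavelength S.
Hypothesis hhB : 0 <= height S.
Hypothesis hr : height S < distance S.
Hypothesis hp : forall k : 'I_(K S), 0 <= weight k <= 1.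
Hypothesis hp1 : \sum_(k < K S) weight k = 1.
Hypothesis hsigma : forall k : 'I_(K S), 0 < stdev k.

Local Notation W_t := ('M[C]_(Nt S)).

Let rate_mx (W : W_t) : 'M[C]_(Nu S) :=
  1%:M + ((sigma_c S ^+ 2)^-1)%:C *: (channel S *m W *m (channel S)^t*).

Lemma psd_rate_term (W : W_t) : psd W ->
  psd (((sigma_c S ^+ 2)^-1)%:C *: (channel S *m W *m (channel S)^t*)).
Proof.
move=> pW; apply: hermpsdZ; first by rewrite ler0c invr_ge0 sqr_ge0.
exact: hermpsd_congr.
Qed.

Lemma rate0 : rate S 0 = 0.
Proof.
by rewrite /rate mulmx0 mul0mx scaler0 addr0 det1 /log2 ln1 mul0r.
Qed.

Lemma rate_concave (W1 W2 : W_t) (s : R) : 0 <= s <= 1 -> psd W1 -> psd W2 ->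
  s * rate S W1 + (1 - s) * rate S W2 <=
  rate S (s%:C *: W1 + (1 - s)%:C *: W2).
Proof.
move=> s01 p1 p2; rewrite /rate /log2 !mulrA -mulrDl ler_pM2r; last first.
  by rewrite invr_gt0 ln_gt0// ltr1n.
have -> : 1%:M + ((sigma_c S ^+ 2)^-1)%:C *: (channel S *m
      (s%:C *: W1 + (1 - s)%:C *: W2) *m (channel S)^t*) =
    s%:C *: rate_mx W1 + (1 - s)%:C *: rate_mx W2.
  by apply: congr_affine; rewrite -rmorphD addrC subrK.
apply: logdet_concave => //.
- by apply: hermpsdD; [exact: hermpsd1|exact: psd_rate_term].
- by apply: hermpsdD; [exact: hermpsd1|exact: psd_rate_term].
- exact/det1D_psd_gt0/psd_rate_term.
- exact/det1D_psd_gt0/psd_rate_term.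
Qed.

(** The beampattern a^H W a in eigenvector coordinates, kept real. *)
Let gain (u : 'I_(Nt S) -> R) (w : 'I_(Nt S) -> 'cV[C]_(Nt S)) x : R :=
  \sum_i u i * complex.Re `|((a S x)^t* *m w i) 0 0| ^+ 2.

Let form_gain (W : W_t) u w x : eigendecomposition W u w ->
  ((a S x)^t* *m W *m a S x) 0 0 = (gain u w x)%:C.
Proof.
move=> [_ _ _ eW]; rewrite {1}eW eigen_form /gain rmorph_sum.
apply: eq_bigr => i _.
by rewrite rmorphM; congr (_ * _); symmetry; exact: norm_sqrC.
Qed.

Lemma mxtrace_A4_eigen (W : W_t) u w : eigendecomposition W u w ->
  \tr (A4 S *m W) = ((Nr S)%:R * \int[mu]_x (gain u w x * prior S x))%:C.
Proof.
move=> dW; have e x : (prior S x)%:C * ((a S x)^t* *m W *m a S x) 0 0 =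
    (gain u w x * prior S x)%:C.
  by rewrite (form_gain _ dW) mulrC rmorphM.
by rewrite mxtrace_A4// (funext e) cintegral_real rmorphM/= rmorph_nat.
Qed.

Lemma mxtrace_A4_gt0 (W : W_t) : psd W -> W != 0 -> 0 < \tr (A4 S *m W).
Proof.
move=> pW W0; have [u [w dW]] := psd_eigendecomposition pW.
rewrite (mxtrace_A4_eigen dW).
have [u0 _ on eW] := dW.
rewrite ltcR mulr_gt0 ?ltr0n//.
have term0 x i : 0 <= u i * complex.Re `|((a S x)^t* *m w i) 0 0| ^+ 2.
  by rewrite mulr_ge0// exprn_ge0// Re_ge0.
have [i ui] : exists i, 0 < u i.
  apply: contrapT => n; move/eqP : W0; apply; rewrite eW; apply: big1 => i _.
  suff -> : u i = 0 by rewrite rmorph0 scale0r.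
  by apply/eqP; rewrite eq_le u0 andbT leNgt; apply/negP => ?; apply: n; exists i.
(* An eigenvector orthogonal to the whole array manifold would be zero, but it has unit norm. *)
have [x0 hx0] : exists x0, ((a S x0)^t* *m w i) 0 0 != 0.
  apply: contrapT => n; have wi0 : w i = 0.
    apply: (@steering_total _ S) => // x; apply/eqP/negPn/negP => ?.
    by apply: n; exists x.
  by have := on i i; rewrite wi0 mulmx0 mxE eqxx => /eqP; rewrite eq_sym oner_eq0.
have cg : continuous (gain u w).
  have [[cf _] _] := cbounded_continuous_form W.
  have -> : gain u w = fun x => complex.Re (((a S x)^t* *m W *m a S x) 0 0).
    by apply/funext => x; rewrite (form_gain _ dW).
  exact: cf.
apply: (@continuous_Rintegral_gt0 _ _ x0).
- by move=> x; apply: cvgM; [exact: cg|exact: continuous_prior].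
- move=> x; apply: mulr_ge0; first by apply: sumr_ge0 => j _; exact: term0.
  exact/ltW/prior_gt0.
- have [ir _] := cintegrable_form W.
  have -> : (fun x => gain u w x * prior S x) =
      (fun x => complex.Re ((prior S x)%:C * ((a S x)^t* *m W *m a S x) 0 0)).
    by apply/funext => x; rewrite (form_gain _ dW) complex_ReM/= mul0r subr0 mulrC.
  exact: ir.
apply: mulr_gt0; last exact: prior_gt0.
rewrite /gain (bigD1 i)//=; apply: ltr_pwDl; last by apply: sumr_ge0 => j _; exact: term0.
apply: mulr_gt0 => //; apply: exprn_gt0; move: hx0; rewrite -normr_gt0; exact: Re_gt0.
Qed.

(* The value of t at which the Schur complement constraint of (P3) becomes tight. *)
Definition sensing_value (W : W_t) : R :=
  complex.Re (\tr ((A1 S + A2 S) *m W))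
  - complex.Re `|\tr (A3 S *m W)| ^+ 2 / complex.Re (\tr (A4 S *m W)).

Lemma PCRBE W : PCRB S W = 1 / (prior_information S + snr_factor S * sensing_value W).
Proof. by []. Qed.

Lemma snr_factor_gt0 : 0 < snr_factor S.
Proof.
have a0 : 0 < complex.Re `|alpha S| by apply: Re_gt0; rewrite normr_gt0.
rewrite /snr_factor; apply: divr_gt0; last exact: exprn_gt0.
apply: mulr_gt0; last by rewrite ltr0n.
by apply: mulr_gt0 => //; exact: exprn_gt0.
Qed.

Lemma mxtrace_A12_ge0 (W : W_t) : psd W -> 0 <= \tr ((A1 S + A2 S) *m W).
Proof.
move=> pW; rewrite mulmxDl mxtraceD addr_ge0//.
  exact: mxtrace_A1_ge0.
exact: mxtrace_A2_ge0.
Qed.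

Lemma sensing_valueP (W : W_t) (t : R) : psd W -> 0 < \tr (A4 S *m W) ->
  (`|\tr (A3 S *m W)| ^+ 2 / \tr (A4 S *m W) <= \tr ((A1 S + A2 S) *m W) - t%:C) =
  (t <= sensing_value W).
Proof.
move=> pW T4; exact: (schur_le_real _ _ T4 (mxtrace_A12_ge0 pW)).
Qed.

Lemma schur_block_psd (W : W_t) t : psd W -> 0 < \tr (A4 S *m W) ->
  psd (schur_block S W t) <-> t <= sensing_value W.
Proof.
move=> pW T4; have [/hermsymmxP hW _] := pW.
have T12 := mxtrace_A12_ge0 pW.
have xr : \tr ((A1 S + A2 S) *m W) - t%:C \is Num.real.
  by apply: rpredB; [exact: ger0_real|apply/complex_realP; exists t].
have := hermpsd_block_mxtrace (A3 S) hW xr T4.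
by rewrite (sensing_valueP _ pW T4).
Qed.

(** The case t = 0 of the Schur inequality: Cauchy-Schwarz lets the [A2] term absorb the quotient,
    and the [A1] term is nonnegative. *)
Lemma sensing_value_ge0 (W : W_t) : psd W -> 0 < \tr (A4 S *m W) ->
  0 <= sensing_value W.
Proof.
move=> pW T4; rewrite -sensing_valueP// rmorph0 subr0.
apply: le_trans (mxtrace_A3_le hNr hp hp1 hsigma pW T4) _.
by rewrite mulmxDl mxtraceD lerDr mxtrace_A1_ge0.
Qed.

(** The power budget bounds the trace of W and hence its entries; this keeps the supremum in (P3)
    finite. *)
Lemma sensing_value_le (W : W_t) :
  psd W -> 0 < \tr (A4 S *m W) -> complex.Re (\tr W) <= power S ->
  sensing_value W <=
    complex.Re (\sum_i \sum_j `|(A1 S + A2 S) i j|) * power S.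
Proof.
move=> pW T4 trW; have T12 := mxtrace_A12_ge0 pW.
set c : C := \sum_i _; have c0 : 0 <= c by do 2 (apply: sumr_ge0 => ? _).
have h : \tr ((A1 S + A2 S) *m W) <= c * \tr W.
  by rewrite -[leLHS]ger0_norm//; exact: mxtrace_mul_bounded.
have tr0 : 0 <= \tr W.
  by apply: sumr_ge0 => i _; exact: hermpsd_diag_ge0.
apply: (@le_trans _ _ (complex.Re (\tr ((A1 S + A2 S) *m W)))).
  rewrite /sensing_value gerBl divr_ge0//; first by rewrite exprn_ge0// Re_ge0.
  exact/Re_ge0/ltW.
have : complex.Re (\tr ((A1 S + A2 S) *m W)) <= complex.Re (c * \tr W).
  by move: h; rewrite lecE => /andP[].
move=> /le_trans; apply.
rewrite complex_ReM (ger0_Im c0) mul0r subr0.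
by rewrite ler_wpM2l// Re_ge0.
Qed.

Lemma P1_feasible_neq0 (W : W_t) : P1_feasible S W -> W != 0.
Proof.
move=> [h _ _]; apply: contraTneq h => ->.
by rewrite rate0 -ltNge.
Qed.

Lemma P1_feasible_A4 (W : W_t) : P1_feasible S W -> 0 < \tr (A4 S *m W).
Proof. by move=> fW; apply: mxtrace_A4_gt0; [case: fW|exact: P1_feasible_neq0]. Qed.

(** (P3) is thus the hypograph form of maximising [sensing_value] over the feasible set of (P1). *)
Lemma P3_feasibleP (W : W_t) (t : R) :
  feasible (P3 S) (W, t) <-> P1_feasible S W /\ t <= sensing_value W.
Proof.
split=> [[/= pW hg hl]|[fW ht]].
  have fW : P1_feasible S W.
    split => //; rewrite -subr_ge0.
      by have := hg _ (or_introl erefl).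
    by have := hg _ (or_intror (or_introl erefl)).
  by split => //; apply/schur_block_psd => //; exact: P1_feasible_A4.
have [h1 h2 pW] := fW; split => //=.
  by move=> g [<-|[<-|//]]; rewrite /= subr_ge0.
by apply/schur_block_psd => //; exact: P1_feasible_A4.
Qed.

(** Both denominators are positive, so taking reciprocals reverses the order. *)
Lemma PCRB_le (W1 W2 : W_t) : P1_feasible S W1 -> P1_feasible S W2 ->
  (PCRB S W1 <= PCRB S W2) = (sensing_value W2 <= sensing_value W1).
Proof.
move=> f1 f2; have I0 := prior_information_gt0 hp hp1 hsigma; have s0 := snr_factor_gt0.
have den W : P1_feasible S W -> 0 < prior_information S + snr_factor S * sensing_value W.
  move=> fW; rewrite ltr_pwDl// mulr_ge0 ?(ltW s0)//.
  by apply: sensing_value_ge0; [case: fW|exact: P1_feasible_A4].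
by rewrite !PCRBE !div1r lef_pV2 ?posrE ?den// lerD2l ler_pM2l.
Qed.

Lemma P1_optimalP (W : W_t) : P1_optimal S W <-> exists t, optimal (P3 S) (W, t).
Proof.
split=> [[fW opt]|[t [/P3_feasibleP[fW tW] opt]]].
  (* The largest t feasible together with W. *)
  exists (sensing_value W); split; first by apply/P3_feasibleP.
  move=> [W' t'] /P3_feasibleP[fW' tW']; apply: le_trans tW' _.
  by rewrite /= -PCRB_le// opt.
split => // W' fW'; rewrite PCRB_le//; apply: le_trans tW.
by apply: (opt (W', sensing_value W')); apply/P3_feasibleP.
Qed.

Lemma inf_PCRB : P1_feasible S !=set0 ->
  inf [set PCRB S W | W in P1_feasible S] =
  1 / (prior_information S
       + snr_factor S * sup [set objective (P3 S) x | x in feasible (P3 S)]).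
Proof.
move=> ne; apply: (inf_inv_affine (prior_information_gt0 hp hp1 hsigma) snr_factor_gt0 ne).
  move=> W fW; have [_ trW pW] := fW; have T4 := P1_feasible_A4 fW.
  by rewrite sensing_value_ge0//=; exact: sensing_value_le.
move=> t; split=> [[[W t'] /P3_feasibleP[fW tW] <-]|[W fW tW]]; first by exists W.
by exists (W, t) => //; apply/P3_feasibleP.
Qed.

Lemma schur_block_affine (s x y : R) (X Y : W_t) :
  schur_block S (s%:C *: X + (1 - s)%:C *: Y) (s * x + (1 - s) * y) =
  s%:C *: schur_block S X x + (1 - s)%:C *: schur_block S Y y.
Proof.
apply: block_mxtrace_affine.
by rewrite (rmorphD (real_complex R)) !(rmorphM (real_complex R)).
Qed.

Lemma concave_subr (s r1 r2 r c : R) : s * r1 + (1 - s) * r2 <= r ->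
  s * (r1 - c) + (1 - s) * (r2 - c) <= r - c.
Proof. by lra. Qed.

Lemma affine_subl (s r1 r2 r c : R) : r = s * r1 + (1 - s) * r2 ->
  s * (c - r1) + (1 - s) * (c - r2) <= c - r.
Proof. by move=> ->; lra. Qed.

Lemma Re_mxtrace_affine (s t : R) (X Y : W_t) :
  complex.Re (\tr (s%:C *: X + t%:C *: Y)) =
  s * complex.Re (\tr X) + t * complex.Re (\tr Y).
Proof.
by rewrite mxtraceD !mxtraceZ complex_ReD !complex_ReM !mul0r !subr0.
Qed.

Lemma P3_convex : convex_program (P3 S).
Proof.
have sc (s : R) : 0 <= s <= 1 -> 0 <= s%:C :> C /\ 0 <= (1 - s)%:C :> C.
  by move=> /andP[? ?]; rewrite !ler0c subr_ge0.
split.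
- move=> s x y /sc[s0 s1] px py.
  exact: (hermpsdD (hermpsdZ s0 px) (hermpsdZ s1 py)).
- by move=> s x y _ _ _; exact: lexx.
- move=> g [<-|[<-|[]]] s x y s01 px py.
    exact: (concave_subr _ (rate_concave s01 px py)).
  exact: (affine_subl _ (Re_mxtrace_affine _ _ _ _)).
(* The block matrix is affine in (W, t), so its concavity defect is the zero matrix. *)
- move=> s x y _ _ _; rewrite [lmi _ _]schur_block_affine subrr; exact: hermpsd0.
Qed.

End Optimization.

Theorem mainTheorem3 (R : realType) (S : system R)
  (hNt : (0 < Nt S)%N) (hNr : (0 < Nr S)%N) (hNu : (0 < Nu S)%N)
  (hL : (0 < L S)%N)
  (hRbar : 0 < rate_threshold S)
  (hsigma_c : 0 < sigma_c S) (hsigma_s : 0 < sigma_s S)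
  (halpha : alpha S != 0)
  (hd : 0 < spacing S) (hlambda : 0 < wavelength S)
  (hhB : 0 <= height S) (hr : height S < distance S)
  (hK : (0 < K S)%N)
  (hp : forall k : 'I_(K S), 0 <= weight k <= 1)
  (hp1 : \sum_(k < K S) weight k = 1)
  (hmean : forall k : 'I_(K S), - (pi / 2) <= mean k < pi / 2)
  (hsigma : forall k : 'I_(K S), 0 < stdev k)
  (hfeasible : P1_feasible S !=set0) :
  (* positivity of tr(A4 W) on the feasible set *)
  (forall W, P1_feasible S W ->
     (exists u w, eigendecomposition W u w) /\
     (forall u w, eigendecomposition W u w ->
        \tr (A4 S *m W) =
          ((Nr S)%:R * \int[lebesgue_measure]_theta
             ((\sum_i u i * complex.Re `|((a S theta)^t* *m w i) 0 0| ^+ 2)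
              * prior S theta))%:C) /\
     0 < \tr (A4 S *m W)) /\
  (* equivalence of (P1) and (P3): optimal values correspond, and the optimal W
     of (P1) are exactly the W-parts of the optimal solutions of (P3) *)
  inf [set PCRB S W | W in P1_feasible S] =
    1 / (prior_information S
         + snr_factor S * sup [set objective (P3 S) x | x in feasible (P3 S)]) /\
  (forall W, P1_optimal S W <-> exists t, optimal (P3 S) (W, t)) /\
  convex_program (P3 S).
Proof.
split; last split; last split.
- move=> W fW; have [_ _ pW] := fW; split; first exact: psd_eigendecomposition.
  split; first by move=> u w; exact: mxtrace_A4_eigen.
  exact: P1_feasible_A4.
- exact: inf_PCRB.
- by move=> W; exact: P1_optimalP.
- exact: P3_convex.
Qed.
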